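(* There exist constants $c_1, c_2, c_3$ such that for every constant $k$ and every $p \geq \Omega\left(n^{-2/(k-1)}\right)$, the $(\mathcal{G}_{n,p}, \rho_k)$-quality control problem satisfies the following: (1) it is solvable with $O(p^{-c_1 k})$ adjacency matrix queries to the input graph $G$; (2) when additionally $p = \Omega\left((\log(n)/n)^{1/(4k-1)}\right)$, it is also solvable in $O(p^{-c_3 k})$ time; (3) no algorithm solves this problem with $o(p^{-c_2 k})$ queries.
   Context: Quality control: let $\mathcal{X}$ be a set, $\rho:\mathcal{X}\to\mathbb{R}_{\ge 0}$, $\varepsilon>0$ a fixed small constant, and $\mathcal{D}$ a distribution on $\mathcal{X}$ with $\Pr_{x\sim\mathcal{D}}[|\rho(x)-1|\le\varepsilon]\ge 9/10$. A (randomized) $(\mathcal{D},\rho)$-quality control algorithm $A$ must satisfy: (i) $\Pr_{x\sim\mathcal{D},R}[A(x)=\textsc{Accept}]\ge 2/3$, where $R$ is the algorithm's internal randomness; (ii) for every $x$ with $|\rho(x)-1|>\varepsilon$, $\Pr_R[A(x)=\textsc{Reject}]\ge 2/3$. Here inputs are graphs on vertex set $[n]$, accessed by adjacency matrix queries: a query $(u,v)$ returns $1$ if $\{u,v\}$ is an edge and $0$ otherwise. $\mathcal{G}_{n,p}$ is the Erdős–Rényi distribution (each pair is an edge independently with probability $p$). $C_k(G)$ denotes the number of (labeled) $k$-cliques of $G$, and $\rho_k(G) = C_k(G)/\mathbb{E}_{G'\sim\mathcal{G}_{n,p}}[C_k(G')]$. The accuracy $\varepsilon$ is treated as a constant. 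*)

(* Defs.v *)
From HB Require Import structures.
From mathcomp Require Export all_boot all_order all_algebra.
From mathcomp Require Export all_classical all_reals all_analysis.

Set Implicit Arguments.
Unset Strict Implicit.
Unset Printing Implicit Defensive.

Import Order.TTheory GRing.Theory Num.Theory.
Import numFieldNormedType.Exports.

Local Open Scope ring_scope.

Record fdist (R : realType) (T : finType) := FDist {
  mass :> T -> R;
  mass_ge0 : forall x, 0 <= mass x;
  mass_sum1 : \sum_x mass x = 1 }.

Lemma unif_ge0 (R : realType) (m : nat) (i : 'I_m.+1) : 0 <= m.+1%:R^-1 :> R.
Proof. by rewrite invr_ge0 ler0n. Qed.

Lemma unif_sum1 (R : realType) (m : nat) :
  \sum_(i < m.+1) m.+1%:R^-1 = 1 :> R.
Proof.
by rewrite sumr_const card_ord -[_ *+ _]mulr_natl divff // pnatr_eq0.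
Qed.

Definition unif (R : realType) (m : nat) : fdist R 'I_m.+1 :=
  FDist (@unif_ge0 R m) (@unif_sum1 R m).

Section QualityControl.
Variables (R : realType) (X : finType).
Variables (D : fdist R X) (rho : X -> R) (eps : R).

Definition concentrated : Prop :=
  9 / 10 <= \sum_(x | `|rho x - 1| <= eps) D x.

(* [out x b] is the probability, over the internal randomness only, that the
   algorithm answers [b] on input [x]; [true] is Accept, [false] is Reject. *)
Definition quality_control (out : X -> bool -> R) : Prop :=
  2 / 3 <= \sum_x D x * out x true /\
  (forall x, eps < `|rho x - 1| -> 2 / 3 <= out x false).

End QualityControl.

(* An unordered pair {u, v} of distinct vertices is represented by (u, v) with
   u < v; a simple graph is an arbitrary set of such pairs. *)
Definition vpair (n : nat) := {e : 'I_n * 'I_n | (e.1 < e.2)%N}.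

Definition graph (n : nat) := {set vpair n}.

Definition adj (n : nat) (G : graph n) (u v : 'I_n) : bool :=
  [exists e in G, (val e == (u, v)) || (val e == (v, u))].

(* Labeled k-cliques: ordered k-tuples of pairwise adjacent vertices (which are
   then distinct). *)
Definition cliques (n k : nat) (G : graph n) : nat :=
  #|[set f : {ffun 'I_k -> 'I_n} |
      [forall i, forall j, (i != j) ==> adj G (f i) (f j)]]|.

Definition gnp_mass (R : realType) (n : nat) (p : R) (G : graph n) : R :=
  \prod_(e : vpair n) (if e \in G then p else 1 - p).

Lemma gnp_mass_ge0 (R : realType) (n : nat) (p : R) (p01 : 0 <= p <= 1)
  (G : graph n) : 0 <= gnp_mass p G.
Proof.
have /andP[p0 p1] := p01.
by apply: prodr_ge0 => e _; case: ifP; rewrite // subr_ge0.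
Qed.

Lemma gnp_mass_sum1 (R : realType) (n : nat) (p : R) :
  \sum_(G : graph n) gnp_mass p G = 1.
Proof.
transitivity (\prod_(e : vpair n) (p + (1 - p))).
  by rewrite bigA_distr; apply: eq_bigl => G; rewrite inE.
by rewrite big1 // => e _; rewrite addrC subrK.
Qed.

Definition gnp (R : realType) (n : nat) (p : R) (p01 : 0 <= p <= 1) :
  fdist R (graph n) := FDist (gnp_mass_ge0 p01) (@gnp_mass_sum1 R n p).

Definition rho_clique (R : realType) (n k : nat) (p : R) (p01 : 0 <= p <= 1)
  (G : graph n) : R :=
  (cliques k G)%:R / \sum_(G' : graph n) gnp n p01 G' * (cliques k G')%:R.

(* Randomized decision trees. [Draw] is a step of internal randomness with an
   arbitrary finite distribution. *)
Inductive ralg (R : realType) (n : nat) (X : Type) : Type :=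
| Output of X
| Query of 'I_n & 'I_n & (bool -> ralg R n X)
| Draw (m : nat) of fdist R 'I_m & ('I_m -> ralg R n X).

Arguments Output {R n X}.
Arguments Query {R n X}.
Arguments Draw {R n X m}.

Fixpoint pr_output (R : realType) (n : nat) (X : eqType) (A : ralg R n X)
  (G : graph n) (y : X) : R :=
  match A with
  | Output x => (x == y)%:R
  | Query u v f => pr_output (f (adj G u v)) G y
  | Draw m mu f => \sum_(i < m) mu i * pr_output (f i) G y
  end.

(* Worst case over the oracle answers and the internal randomness. *)
Fixpoint queries (R : realType) (n : nat) (X : Type) (A : ralg R n X) : nat :=
  match A with
  | Output _ => 0
  | Query _ _ f => (maxn (queries (f true)) (queries (f false))).+1
  | Draw m _ f => \max_(i < m) queries (f i)
  end.

(* A randomized word RAM with oracle access to the adjacency matrix, in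
   structured form. *)
Inductive wop := OpAdd | OpSub | OpMul | OpDiv | OpMod | OpLt.

(* [Cell e] is the content of the memory cell whose address is the value of
   [e]. *)
Inductive expr :=
| Const of nat
| Cell of expr
| Bin of wop & expr & expr.

(* [Store a e]: write the value of [e] at address [a].
   [Ask a u v]: write at address [a] the answer to the query (u, v) (0 if u or
   v is not a vertex).
   [Rnd a e]: write at address [a] a uniform element of {0, ..., e - 1} (0 if
   e = 0). *)
Inductive cmd :=
| Skip
| Store of expr & expr
| Ask of expr & expr & expr
| Rnd of expr & expr
| Seq of cmd & cmd
| If of expr & cmd & cmd
| While of expr & cmd.

Definition memory := nat -> nat.

Definition apply_op (o : wop) (a b : nat) : nat :=
  match o with
  | OpAdd => a + b
  | OpSub => a - b
  | OpMul => a * b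
  | OpDiv => a %/ b
  | OpMod => a %% b
  | OpLt => (a < b)%N
  end%N.

(* Word arithmetic: every result is reduced modulo [W]; subtraction is
   truncated at 0. *)
Fixpoint eval (W : nat) (m : memory) (e : expr) : nat :=
  match e with
  | Const c => (c %% W)%N
  | Cell a => m (eval W m a)
  | Bin o a b => (apply_op o (eval W m a) (eval W m b) %% W)%N
  end.

Definition write (W : nat) (m : memory) (a v : nat) : memory :=
  fun b => if b == a then (v %% W)%N else m b.

(* [exec W t s m] executes the list of commands [s] from the memory [m] for at
   most [t] steps, where every command or loop test counts for one step (the
   expressions of a program have constant size). The output is [None] if the
   program has not halted after [t] steps; otherwise it is read in cell 0. *)
Fixpoint exec (R : realType) (n W t : nat) (s : seq cmd) (m : memory) :
  ralg R n (option bool) :=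
  match s, t with
  | [::], _ => Output (Some (m 0%N != 0%N))
  | _ :: _, 0%N => Output None
  | c :: s', t'.+1 =>
    match c with
    | Skip => exec R n W t' s' m
    | Store a e => exec R n W t' s' (write W m (eval W m a) (eval W m e))
    | Ask a u v =>
      match (insub (eval W m u) : option 'I_n),
            (insub (eval W m v) : option 'I_n) with
      | Some i, Some j =>
        Query i j (fun b : bool => exec R n W t' s' (write W m (eval W m a) b))
      | _, _ => exec R n W t' s' (write W m (eval W m a) 0)
      end
    | Rnd a e =>
      match eval W m e with
      | 0%N => exec R n W t' s' (write W m (eval W m a) 0)
      | r.+1 =>
        Draw (unif R r) (fun i => exec R n W t' s' (write W m (eval W m a) i))
      end
    | Seq c1 c2 => exec R n W t' (c1 :: c2 :: s') m
    | If e c1 c2 =>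
      exec R n W t' ((if eval W m e != 0%N then c1 else c2) :: s') m
    | While e c1 =>
      exec R n W t' (if eval W m e != 0%N then c1 :: c :: s' else s') m
    end
  end.

(* Words have d * (log2 n + 1) bits. *)
Definition word_modulus (d n : nat) : nat := 2 ^ (d * (trunc_log 2 n).+1).

(* The input consists of n (cell 0) and of p rounded down to a multiple of
   n^-e, given as the integer floor (p * n^e) (cell 1). *)
Definition input (R : realType) (d e n : nat) (p : R) : memory :=
  let W := word_modulus d n in
  write W (write W (fun=> 0%N) 0 n) 1 (Num.truncn (p * (n ^ e)%:R)).

Definition run (R : realType) (c : cmd) (d e n : nat) (p : R) (t : nat) :
  ralg R n (option bool) :=
  exec R n (word_modulus d n) t [:: c] (input d e n p).

Definition halts (R : realType) (n : nat) (A : ralg R n (option bool)) : Prop :=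
  forall G : graph n, pr_output A G None = 0.

Section CliqueQualityControl.
Variables (R : realType) (k : nat) (eps : R).
Variables (p : nat -> R) (p01 : forall n, 0 <= p n <= 1).

Definition clique_concentrated (n : nat) : Prop :=
  concentrated (gnp n (p01 n)) (rho_clique k (p01 n)) eps.

Definition clique_qc (n : nat) (out : graph n -> bool -> R) : Prop :=
  quality_control (gnp n (p01 n)) (rho_clique k (p01 n)) eps out.

Local Open Scope classical_set_scope.

Definition solves (A : forall n, ralg R n bool) : Prop :=
  \forall n \near \oo, clique_qc (pr_output (A n)).

(* The program [c] and the constants [d], [e] do not depend on [n]. *)
Definition solves_in_time (c : cmd) (d e : nat) (T : nat -> nat) : Prop :=
  \forall n \near \oo,
    halts (run c d e n (p n) (T n)) /\
    clique_qc (fun G b => pr_output (run c d e n (p n) (T n)) G (Some b)).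

End CliqueQualityControl.

(* Main.v *)
(** Let [q] be [p] rounded to a multiple of [1 / n], [g := A - q] with [A] the
    adjacency matrix, and [mu := E g(u,y) g(u,z) g(v,y) g(v,z)] over uniform
    vertices [u v y z]. Two applications of Cauchy-Schwarz turn a bound
    [mu <= (delta q^(k-1))^4] into a bound on the bilinear form of [g]; used
    edge by edge, it forces the number of k-cliques to be close to
    [q^C(k,2) n^k]. Conversely, in a random graph [mu] has expectation at most
    [7 / n], since four distinct entries of [g] have mean at most [n^-1] each.
    So once [n p^(4k-1)] is a large constant, it suffices to estimate [mu] up to
    [p^O(k)], which [p^-O(k)] samples do by Chebyshev's inequality: this is (2),
    and (1) as well, because for smaller [n] the whole graph has only
    [p^-O(k)] entries.

    For (3), split the vertices into about [p^(-(k-1)/2)] residue classes.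
    Planting a clique on any one of them makes the clique count too large, and
    an algorithm with few queries misses most classes, so that it cannot accept
    any graph with probability 2/3. *)

From mathcomp Require Import ring lra zify.
Require Import Defs.

Set Implicit Arguments.
Unset Strict Implicit.
Unset Printing Implicit Defensive.

Import Order.TTheory GRing.Theory Num.Theory.
Import numFieldNormedType.Exports.

Local Open Scope classical_set_scope.
Local Open Scope ring_scope.

(** * Counting cliques from the box norm *)

(** The obstacle is sparsity: the error must be small relative to [q^C(k,2) n^k], not to [n^k]. So
    edges are exchanged one at a time in a clique with one partially attached vertex. The two test
    functions of the bilinear form are then common neighbourhoods, one inside the other, and the
    error is a multiple of the count with that edge's endpoint removed, which is again a count of
    the same kind. The quantity [mu] is a sum of squares, hence nonnegative, so on the random side
    its mean alone controls the rejection probability. With [r] about [1 / q] and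
    [K = D r^(4(k-1))], a bad graph has [K mu >= 1], while the mean of [K mu] in a random graph is
    at most [7 K / n]; this is where the lower bound on a power of [p] times [n] comes from. The gap
    [1 / K] is resolved by [100 K^2] samples. Rounding [p] to [q = P / n] makes each [n g(x,y)] an
    integer, and adding [n^4] to each product makes it a natural number, so the program computes
    exactly. *)

Lemma cauchy_schwarz_sum (R : realFieldType) (I : finType) (a b : I -> R) :
  (\sum_i a i * b i) ^+ 2 <= (\sum_i a i ^+ 2) * (\sum_i b i ^+ 2).
Proof.
(* Lagrange's identity: this double sum is twice the difference of the two sides. *)
have h0 : 0 <= \sum_i \sum_j (a i * b j - a j * b i) ^+ 2.
  by apply: sumr_ge0 => i _; apply: sumr_ge0 => j _; exact: sqr_ge0.
have e : \sum_i \sum_j (a i * b j - a j * b i) ^+ 2 =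
    ((\sum_i a i ^+ 2) * (\sum_i b i ^+ 2) - (\sum_i a i * b i) ^+ 2) *+ 2.
  rewrite expr2 !big_distrlr /= mulrnBl 2!mulr2n.
  rewrite [X in _ + X - _]exchange_big /= -!big_split /= -!sumrB.
  apply: eq_bigr => i _; rewrite -!big_split /= -!sumrB; apply: eq_bigr => j _.
  by ring.
by move: h0; rewrite e pmulrn_lge0 // subr_ge0.
Qed.

Lemma sum_tuple0 (R : realFieldType) (V : finType) (F : seq V -> R) :
  \sum_(t : 0.-tuple V) F t = F [::].
Proof.
rewrite (bigD1 [tuple]) //= big1 ?addr0 // => t.
by rewrite (tuple0 t) => /eqP.
Qed.

Lemma sum_tupleS (R : realFieldType) (V : finType) (l : nat) (F : seq V -> R) :
  \sum_(t : l.+1.-tuple V) F t = \sum_x \sum_(t : l.-tuple V) F (x :: t).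
Proof.
rewrite pair_bigA /= (reindex (fun u : V * l.-tuple V => [tuple of u.1 :: u.2])) //=.
exists (fun t => (thead t, [tuple of behead t])) => [[x t] _|t _] /=.
  by congr (_, _); apply: val_inj.
by rewrite -tuple_eta.
Qed.

Lemma sum_tuple_rcons (R : realFieldType) (V : finType) (l : nat)
    (F : seq V -> R) :
  \sum_(t : l.+1.-tuple V) F t = \sum_(t : l.-tuple V) \sum_x F (rcons t x).
Proof.
elim: l F => [|l IH] F.
  rewrite sum_tupleS (sum_tuple0 (fun t : seq V => \sum_x F (rcons t x))).
  by apply: eq_bigr => x _; rewrite (sum_tuple0 (fun t : seq V => F (x :: t))).
rewrite sum_tupleS (sum_tupleS _ (fun t : seq V => \sum_x F (rcons t x))).
by apply: eq_bigr => x _; rewrite (IH (fun t : seq V => F (x :: t))).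
Qed.

Section CliqueCounting.
Variables (R : realFieldType) (V : finType) (A : V -> V -> R).

Definition box4 (g : V -> V -> R) : R :=
  \sum_y \sum_z (\sum_x g x y * g x z) ^+ 2.

Definition joined (s : seq V) (y : V) : R := \prod_(x <- s) A x y.

Fixpoint clique_wt (s : seq V) : R :=
  if s is x :: s' then joined s' x * clique_wt s' else 1.

Definition clique_sum (k : nat) : R := \sum_(s : k.-tuple V) clique_wt s.

(* Homomorphic copies of the complete graph on i + l vertices with one more
   vertex attached to i of them. *)
Definition pendant_sum (i l : nat) : R :=
  \sum_(s : i.-tuple V) \sum_(t : l.-tuple V)
    clique_wt (s ++ t) * \sum_y joined s y.

Lemma box4_ge0 (g : V -> V -> R) : 0 <= box4 g.
Proof. by apply: sumr_ge0 => y _; apply: sumr_ge0 => z _; exact: sqr_ge0. Qed.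

(** Since [a <= b <= 1], the squared norms of both [a] and [b] are at most the sum of [b]. The bound
    is therefore linear in that sum, with no factor [#|V|] lost on sparse supports. *)
Lemma box4_bilinear (g : V -> V -> R) (a b : V -> R) (beta : R) :
  0 <= beta -> box4 g <= beta ^+ 4 -> (forall x, 0 <= a x <= b x) ->
  (forall x, b x <= 1) ->
  `|\sum_x \sum_y a x * b y * g x y| <= beta * \sum_y b y.
Proof.
move=> beta0 hS ab b1.
have b0 x : 0 <= b x by have /andP[a0] := ab x; exact: le_trans.
set B := \sum_y b y.
have B0 : 0 <= B by apply: sumr_ge0.
have hb2 : \sum_y b y ^+ 2 <= B.
  by apply: ler_sum => x _; rewrite expr2 ler_piMr.
have ha2 : \sum_y a y ^+ 2 <= B.
  apply: ler_sum => x _; have /andP[a0 ale] := ab x.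
  by rewrite expr2 (le_trans _ ale) // ler_piMr // (le_trans ale).
pose w x := \sum_y b y * g x y.
pose Y := \sum_x w x ^+ 2.
have Y0 : 0 <= Y by apply: sumr_ge0 => x _; exact: sqr_ge0.
(* Written over pairs of columns, [Y] separates the weights [b] from the correlations that [box4]
   squares; this prepares the second use of Cauchy-Schwarz. *)
have YE : Y = \sum_(u : V * V) (b u.1 * b u.2) * (\sum_x g x u.1 * g x u.2).
  rewrite -(pair_bigA _ (fun y z => (b y * b z) * (\sum_x g x y * g x z))) /=.
  transitivity (\sum_x \sum_y \sum_z (b y * g x y) * (b z * g x z)).
    by apply: eq_bigr => x _; rewrite expr2 big_distrlr.
  rewrite exchange_big /=; apply: eq_bigr => y _.
  rewrite exchange_big /=; apply: eq_bigr => z _.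
  by rewrite mulr_sumr; apply: eq_bigr => x _; ring.
have hY : Y <= B * beta ^+ 2.
  rewrite -(@ler_pXn2r _ 2) ?nnegrE // ?mulr_ge0 ?sqr_ge0 // YE.
  apply: le_trans (cauchy_schwarz_sum _ _) _.
  rewrite exprMn -exprM; apply: ler_pM.
  - by apply: sumr_ge0 => u _; exact: sqr_ge0.
  - by apply: sumr_ge0 => u _; exact: sqr_ge0.
  - rewrite -(pair_bigA _ (fun y z => (b y * b z) ^+ 2)) /=.
    rewrite (_ : \sum_y _ = (\sum_y b y ^+ 2) * (\sum_y b y ^+ 2)).
      2: by rewrite big_distrlr; do 2![apply: eq_bigr => ? _]; rewrite exprMn.
    rewrite [leRHS]expr2; apply: ler_pM => //.
      by apply: sumr_ge0 => u _; exact: sqr_ge0.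
    by apply: sumr_ge0 => u _; exact: sqr_ge0.
  - by rewrite -(pair_bigA _ (fun y z => (\sum_x g x y * g x z) ^+ 2)).
have -> : \sum_x \sum_y a x * b y * g x y = \sum_x a x * w x.
  apply: eq_bigr => x _; rewrite mulr_sumr; apply: eq_bigr => y _.
  by rewrite mulrA.
rewrite -(@ler_pXn2r _ 2) ?nnegrE // ?mulr_ge0 // real_normK ?num_real //.
apply: le_trans (cauchy_schwarz_sum _ _) _.
have -> : (beta * B) ^+ 2 = B * (B * beta ^+ 2) by ring.
by apply: ler_pM => //; apply: sumr_ge0 => x _; exact: sqr_ge0.
Qed.

Hypothesis A_sym : forall x y, A x y = A y x.
Hypothesis A01 : forall x y, 0 <= A x y <= 1.

Let A_ge0 x y : 0 <= A x y. Proof. by case/andP: (A01 x y). Qed.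
Let A_le1 x y : A x y <= 1. Proof. by case/andP: (A01 x y). Qed.

Lemma joined_ge0 (s : seq V) (y : V) : 0 <= joined s y.
Proof. exact: prodr_ge0. Qed.

Lemma joined_le1 (s : seq V) (y : V) : joined s y <= 1.
Proof.
elim: s => [|x s IH]; rewrite /joined ?big_nil // big_cons mulr_ile1 //.
exact: joined_ge0.
Qed.

Lemma joined_cat (s t : seq V) (y : V) : joined (s ++ t) y = joined s y * joined t y.
Proof. exact: big_cat. Qed.

Lemma joined_cons (x : V) (s : seq V) (y : V) :
  joined (x :: s) y = A x y * joined s y.
Proof. exact: big_cons. Qed.

Lemma joined_rcons (s : seq V) (x y : V) :
  joined (rcons s x) y = joined s y * A x y.
Proof. by rewrite -cats1 joined_cat {2}/joined big_seq1. Qed.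

Lemma clique_wt_ge0 (s : seq V) : 0 <= clique_wt s.
Proof. by elim: s => //= x s IH; rewrite mulr_ge0 ?joined_ge0. Qed.

Lemma clique_wt_insert (s t : seq V) (x : V) :
  clique_wt (s ++ x :: t) = joined (s ++ t) x * clique_wt (s ++ t).
Proof.
elim: s => //= z s ->; rewrite joined_cons !joined_cat joined_cons (A_sym z x).
by ring.
Qed.

Lemma pendant_sum_ge0 (i l : nat) : 0 <= pendant_sum i l.
Proof.
do 2![apply: sumr_ge0 => ? _]; rewrite mulr_ge0 ?clique_wt_ge0 //.
by apply: sumr_ge0 => y _; exact: joined_ge0.
Qed.

Lemma pendant_sum0l (l : nat) : pendant_sum 0 l = #|V|%:R * clique_sum l.
Proof.
rewrite /pendant_sum.
rewrite (sum_tuple0 (fun s : seq V => \sum_(t : l.-tuple V)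
    clique_wt (s ++ t) * \sum_y joined s y)) /= -mulr_suml mulrC.
congr (_ * _); rewrite (eq_bigr (fun=> 1)); first by rewrite sumr_const.
by move=> y _; rewrite /joined big_nil.
Qed.

Lemma pendant_sum0r (i : nat) : pendant_sum i 0 = clique_sum i.+1.
Proof.
rewrite /clique_sum sum_tupleS exchange_big /=; apply: eq_bigr => s _.
rewrite (sum_tuple0 (fun t : seq V => clique_wt (s ++ t) * \sum_y joined s y)) cats0.
by rewrite mulr_sumr; apply: eq_bigr => y _; rewrite mulrC.
Qed.

(* Turning one edge of density [q] into an edge of [A] costs one application of
   the bilinear bound; the neighbourhood of [x] is contained in that of [y]. *)
Lemma pendant_sum_step (q beta : R) (i l : nat) :
  0 <= beta -> box4 (fun x y => A x y - q) <= beta ^+ 4 ->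
  `|pendant_sum i.+1 l - q * pendant_sum i l.+1| <= beta * pendant_sum i l.
Proof.
move=> beta0 hS; rewrite /pendant_sum.
rewrite (sum_tuple_rcons _ (fun s : seq V => \sum_(t : l.-tuple V)
    clique_wt (s ++ t) * \sum_y joined s y)) !mulr_sumr -sumrB.
apply: le_trans (ler_norm_sum _ _ _) _; apply: ler_sum => s _.
rewrite (sum_tupleS _ (fun t : seq V => clique_wt (s ++ t) * \sum_y joined s y)).
rewrite !mulr_sumr -sumrB.
under eq_bigr do rewrite mulr_sumr -sumrB.
rewrite exchange_big /=.
apply: le_trans (ler_norm_sum _ _ _) _; apply: ler_sum => t _.
set X := \sum_x _.
have -> : X = clique_wt (s ++ t) *
    \sum_x \sum_y joined (s ++ t) x * joined s y * (A x y - q).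
  rewrite mulr_sumr; apply: eq_bigr => x _.
  rewrite cat_rcons clique_wt_insert !mulr_sumr -sumrB.
  apply: eq_bigr => y _.
  by rewrite joined_rcons; ring.
rewrite normrM (ger0_norm (clique_wt_ge0 _)) mulrCA.
apply: ler_wpM2l; first exact: clique_wt_ge0.
apply: box4_bilinear => // x; last exact: joined_le1.
rewrite joined_ge0 /= joined_cat ler_piMr ?joined_ge0 //; exact: joined_le1.
Qed.

Lemma clique_sum0 : clique_sum 0 = 1.
Proof. by rewrite /clique_sum (sum_tuple0 clique_wt). Qed.

(** The value of [pendant_sum] if [A] were constantly [q]: ['C(i + l, 2) + i] edges on [i + l + 1]
    vertices. *)
Let den (q : R) (i l : nat) : R := q ^+ ('C(i + l, 2) + i) * #|V|%:R ^+ (i + l).+1.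

(** The normalised counts [nu i l] move from the empty configuration to the full clique by attaching
    the last vertex one edge at a time. Each of at most [k.+1] edges at each of [k] levels costs at
    most [2 * delta], because the hypothesis on [delta] keeps every [nu] below 2. *)
Lemma clique_count_quasirandom (q delta : R) (k : nat) :
  (0 < #|V|)%N -> 0 < q -> q <= 1 -> 0 <= delta ->
  2 * k.+1%:R ^+ 2 * delta <= 1 ->
  box4 (fun x y => A x y - q) <= (delta * #|V|%:R * q ^+ k) ^+ 4 ->
  `|clique_sum k.+1 - q ^+ 'C(k.+1, 2) * #|V|%:R ^+ k.+1| <=
    2 * k.+1%:R ^+ 2 * delta * (q ^+ 'C(k.+1, 2) * #|V|%:R ^+ k.+1).
Proof.
move=> V0 q0 q1 d0 hd hS; set n : R := #|V|%:R.
have n0 : 0 < n by rewrite ltr0n.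
have den0 i l : 0 < den q i l by rewrite mulr_gt0 ?exprn_gt0.
pose nu i l := pendant_sum i l / den q i l.
(* Normalisation divides the error by [n q^(i+l+1)]; the power [q ^+ k] in the hypothesis absorbs
   this exactly because [i + l < k]. *)
have nu_step i l : (i + l < k)%N -> `|nu i.+1 l - nu i l.+1| <= delta * nu i l.
  move=> ilk.
  have beta0 : 0 <= delta * n * q ^+ k by rewrite !mulr_ge0 ?exprn_ge0 // ltW.
  have := pendant_sum_step i l beta0 hS.
  have denE : den q i.+1 l = q * den q i l.+1.
    by rewrite /den addSn addnS addnS exprS; ring.
  have -> : nu i.+1 l - nu i l.+1 =
      (pendant_sum i.+1 l - q * pendant_sum i l.+1) / den q i.+1 l.
    rewrite /nu denE; field; rewrite !gt_eqF //.
  rewrite normrM normfV (gtr0_norm (den0 _ _)) ler_pdivrMr // => h.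
  apply: le_trans h _.
  have -> : delta * nu i l * den q i.+1 l =
      delta * n * q ^+ (i + l).+1 * pendant_sum i l.
    have -> : den q i.+1 l = n * q ^+ (i + l).+1 * den q i l.
      rewrite /den addSn -/n (exprS n (i + l).+1).
      have -> : ('C((i + l).+1, 2) + i.+1 = (i + l).+1 + ('C(i + l, 2) + i))%N.
        by rewrite binS bin1; lia.
      by rewrite exprD; ring.
    by rewrite /nu; field; rewrite gt_eqF.
  apply: ler_wpM2r; first exact: pendant_sum_ge0.
  apply: ler_wpM2l; first by rewrite mulr_ge0 // ltW.
  by apply: ler_wiXn2l => //; exact: ltW.
have k0 : 0 <= k.+1%:R :> R by [].
have key j : (j <= k)%N -> forall i l, (i + l)%N = j ->
    `|nu i l - 1| <= 2 * k.+1%:R * j%:R * delta.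
  elim: j => [|j IH] jk i l.
    move/eqP; rewrite addn_eq0 => /andP[/eqP-> /eqP->].
    rewrite /nu pendant_sum0l clique_sum0 /den addn0 /= expr0 mul1r mulr1.
    by rewrite expr1 divff ?gt_eqF // subrr normr0 mulr0 mul0r.
  have jle : j%:R <= k%:R :> R by rewrite ler_nat ltnW.
  have bnd a b : (a + b)%N = j -> nu a b <= 2.
    move=> abj; have := IH (ltnW jk) a b abj; rewrite ler_norml => /andP[_].
    rewrite lerBlDr => /le_trans; apply.
    have : 2 * k.+1%:R * j%:R * delta <= 1; last by lra.
    apply: le_trans hd; apply: ler_wpM2r => //; rewrite expr2 mulrA.
    by apply: ler_wpM2l; rewrite ?mulr_ge0 // ler_nat ltnW // ltnW.
  suff H : forall i l, (i + l)%N = j.+1 ->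
      `|nu i l - 1| <= 2 * k.+1%:R * j%:R * delta + 2 * i%:R * delta.
    move=> il; apply: le_trans (H _ _ il) _.
    have : i%:R <= k.+1%:R :> R by rewrite ler_nat; lia.
    rewrite -[j.+1%:R]natr1 => hi; nra.
  elim=> [|a IHa] b.
    rewrite add0n => ->.
    (* An unattached vertex only contributes the factor [n], and a fully attached one completes a
       clique: the end of level [j] is the start of level [j.+1]. *)
    have -> : nu 0%N j.+1 = nu j 0%N.
      rewrite /nu pendant_sum0l pendant_sum0r /den add0n !addn0.
      rewrite binS bin1 [(_ ^+ j.+2)]exprS -/n; field.
      by rewrite !expf_neq0 ?gt_eqF.
    by rewrite mulr0 mul0r addr0; apply: IH (ltnW jk) _ _ _; rewrite addn0.
  rewrite addSn => -[abj].
  have h1 := nu_step a b; rewrite abj in h1; have {}h1 := h1 jk.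
  have h2 := IHa b.+1; rewrite addnS abj in h2; have {}h2 := h2 erefl.
  have h3 := bnd _ _ abj.
  have -> : nu a.+1 b - 1 = (nu a.+1 b - nu a b.+1) + (nu a b.+1 - 1) by ring.
  apply: le_trans (ler_normD _ _) _.
  have : delta * nu a b <= delta * 2 by apply: ler_wpM2l.
  by rewrite -[a.+1%:R]natr1; lra.
have := key k (leqnn k) k 0%N (addn0 k).
rewrite /nu pendant_sum0r.
have -> : den q k 0 = q ^+ 'C(k.+1, 2) * n ^+ k.+1.
  by rewrite /den addn0 binS bin1.
set D := q ^+ _ * _.
have D0 : 0 < D by rewrite mulr_gt0 ?exprn_gt0.
have -> : clique_sum k.+1 / D - 1 = (clique_sum k.+1 - D) / D.
  by field; rewrite gt_eqF.
rewrite normrM normfV (gtr0_norm D0) ler_pdivrMr // => /le_trans; apply.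
apply: ler_wpM2r; first exact: ltW.
apply: ler_wpM2r => //; rewrite expr2 mulrA.
by apply: ler_wpM2l; rewrite ?mulr_ge0 // ler_nat.
Qed.

End CliqueCounting.

(** * Expectations in the random graph *)

Definition adjr (R : realType) (n : nat) (G : graph n) (x y : 'I_n) : R :=
  (adj G x y)%:R.

Lemma adj_sym (n : nat) (G : graph n) (x y : 'I_n) : adj G x y = adj G y x.
Proof. by apply: eq_existsb => e; rewrite orbC. Qed.

Lemma adj_vpair (n : nat) (G : graph n) (e : vpair n) :
  adj G (val e).1 (val e).2 = (e \in G).
Proof.
apply/existsP/idP => [[e' /andP[e'G]]|eG]; last first.
  by exists e; rewrite eG -surjective_pairing eqxx.
case/orP => /eqP E; first by rewrite (_ : e = e') //; apply: val_inj;
  rewrite /= E -surjective_pairing.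
by have := valP e'; rewrite /= E /= ltnNge ltnW // (valP e).
Qed.

Lemma adj_neq (n : nat) (G : graph n) (x y : 'I_n) : adj G x y -> x != y.
Proof.
case/existsP=> e /andP[_ /orP[] /eqP E]; have := valP e; rewrite /= E /=;
  by apply: contraTneq => ->; rewrite ltnn.
Qed.

Definition sort_pair (n : nat) (u : 'I_n * 'I_n) : 'I_n * 'I_n :=
  if (u.1 < u.2)%N then u else (u.2, u.1).

Lemma sort_pair_inj (n : nat) (u v : 'I_n * 'I_n) :
  sort_pair u = sort_pair v -> u = v \/ u = (v.2, v.1).
Proof.
case: u v => [a b] [c d]; rewrite /sort_pair /=.
by case: ifP; case: ifP => _ _ [-> ->]; auto.
Qed.

(** The mass is a product over pairs, so the factors [f] can be absorbed into it; [bigA_distr] then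
    turns the sum over graphs into a product of two-term sums, equal to 1 outside [L]. *)
Lemma gnp_indep_vpair (R : realType) (n : nat) (p : R) (f : bool -> R)
    (L : seq (vpair n)) : uniq L ->
  \sum_(G : graph n) gnp_mass p G * \prod_(e <- L) f (e \in G) =
  (p * f true + (1 - p) * f false) ^+ size L.
Proof.
move=> uL.
transitivity (\sum_(G : graph n) \prod_e
   (if e \in G then p * (if e \in L then f true else 1)
    else (1 - p) * (if e \in L then f false else 1))).
  apply: eq_bigr => G _; rewrite big_uniq //= big_mkcond /= -big_split /=.
  by apply: eq_bigr => e _; case: (e \in G); case: (e \in L).
have E : \prod_(e : vpair n) (p * (if e \in L then f true else 1) +
      (1 - p) * (if e \in L then f false else 1)) =
    (p * f true + (1 - p) * f false) ^+ size L.
  rewrite (eq_bigr (fun e => if e \in L then p * f true + (1 - p) * f false else 1)).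
    rewrite -big_mkcond /= -big_uniq //= big_const_seq count_predT.
    by rewrite iter_mulr_1.
  by move=> e _; case: (e \in L) => //; ring.
rewrite -E bigA_distr; apply: eq_bigl => G; by rewrite inE.
Qed.

(** Distinct ordered pairs may denote the same edge, so independence requires distinctness after
    sorting. It serves clique counts with the indicator and the box norm with the centred entry. *)
Lemma gnp_indep (R : realType) (n : nat) (p : R) (f : bool -> R)
    (L : seq ('I_n * 'I_n)) :
  all (fun u => u.1 != u.2) L -> uniq (map (@sort_pair n) L) ->
  \sum_(G : graph n) gnp_mass p G * \prod_(u <- L) f (adj G u.1 u.2) =
  (p * f true + (1 - p) * f false) ^+ size L.
Proof.
move=> dL uL.
have [L' L'E] : exists L' : seq (vpair n), map val L' = map (@sort_pair n) L.
  elim: L dL {uL} => [|u L IH] /=; first by exists [::].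
  move=> /andP[du /IH[L' L'E]].
  have su : ((sort_pair u).1 < (sort_pair u).2)%N.
    rewrite /sort_pair; case: (ltnP u.1 u.2) => //= h.
    by rewrite ltn_neqAle h eq_sym andbT.
  by exists ((Sub (sort_pair u) su : vpair n) :: L'); rewrite /= L'E.
have uL' : uniq L' by rewrite -(map_inj_uniq val_inj) L'E.
have sz : size L = size L' by rewrite -(size_map (@sort_pair n)) -L'E size_map.
rewrite sz -(gnp_indep_vpair p f uL'); apply: eq_bigr => G _; congr (_ * _).
transitivity (\prod_(u <- map (@sort_pair n) L) f (adj G u.1 u.2)).
  rewrite big_map; apply: eq_bigr => -[a b] _; rewrite /sort_pair /=.
  by case: ifP => //= _; rewrite adj_sym.
by rewrite -L'E big_map; apply: eq_bigr => e _; rewrite adj_vpair.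
Qed.

Fixpoint clique_pairs (n : nat) (s : seq 'I_n) : seq ('I_n * 'I_n) :=
  if s is x :: s' then [seq (y, x) | y <- s'] ++ clique_pairs s' else [::].

Lemma clique_wt_pairs (R : realType) (n : nat) (G : graph n) (s : seq 'I_n) :
  clique_wt (adjr R G) s = \prod_(u <- clique_pairs s) (adj G u.1 u.2)%:R.
Proof.
elim: s => [|x s IH] /=; first by rewrite big_nil.
by rewrite big_cat big_map /= IH.
Qed.

Lemma size_clique_pairs (n : nat) (s : seq 'I_n) :
  size (clique_pairs s) = 'C(size s, 2).
Proof.
by elim: s => [|x s IH] //=; rewrite size_cat size_map IH binS bin1 addnC.
Qed.

Lemma mem_clique_pairs (n : nat) (s : seq 'I_n) (u : 'I_n * 'I_n) :
  u \in clique_pairs s -> (u.1 \in s) && (u.2 \in s).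
Proof.
elim: s => //= x s IH; rewrite mem_cat => /orP[/mapP[y ys ->]|/IH/andP[h1 h2]] /=.
  by rewrite !inE ys eqxx orbT.
by rewrite !inE h1 h2 !orbT.
Qed.

Lemma clique_pairs_neq (n : nat) (s : seq 'I_n) : uniq s ->
  all (fun u => u.1 != u.2) (clique_pairs s).
Proof.
elim: s => //= x s IH /andP[xs us]; rewrite all_cat IH // andbT.
by apply/allP => _ /mapP[y ys ->] /=; apply: contraNneq xs => <-.
Qed.

Lemma clique_pairs_uniq (n : nat) (s : seq 'I_n) : uniq s ->
  uniq (map (@sort_pair n) (clique_pairs s)).
Proof.
elim: s => //= x s IH /andP[xs us]; rewrite map_cat cat_uniq IH // andbT.
apply/andP; split.
  rewrite -map_comp map_inj_in_uniq // => y z ys zs /= /sort_pair_inj[[]//|/= [_ E]].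
  by move: xs; rewrite E zs.
apply/hasPn => _ /mapP[u /mem_clique_pairs/andP[h1 h2] ->].
apply/negP; rewrite -map_comp => /mapP[y ys /= /sort_pair_inj[E|E]].
  by move: xs h2; rewrite E /= => /negP.
by move: xs h1; rewrite E /= => /negP.
Qed.

Lemma clique_wt_pairwise (R : realType) (n : nat) (G : graph n) (s : seq 'I_n) :
  clique_wt (adjr R G) s = (pairwise (adj G) s)%:R.
Proof.
elim: s => [|x s IH] //=; rewrite IH -mulnb natrM; congr (_ * _).
elim: s {IH} => [|y s IH]; first by rewrite /joined big_nil.
by rewrite joined_cons IH /= -mulnb natrM /adjr adj_sym.
Qed.

Lemma cliquesE (R : realType) (n k : nat) (G : graph n) :
  (cliques k G)%:R = clique_sum (adjr R G) k.
Proof.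
rewrite /cliques -sum1_card natr_sum big_mkcond /= /clique_sum.
rewrite [RHS](reindex (fun f : {ffun 'I_k -> 'I_n} => [tuple f i | i < k])) /=.
  apply: eq_bigr => f _; rewrite clique_wt_pairwise inE.
  suff -> : pairwise (adj G) [tuple f i | i < k] =
      [forall i, forall j, (i != j) ==> adj G (f i) (f j)] by case: ifP.
  (* [pairwiseP] needs a default element, available as [f ord0] only when the tuple is nonempty. *)
  case: k f => [|k] f.
    rewrite (size0nil (size_tuple [tuple f i | i < 0])).
    by apply/esym/forallP => -[].
  have szt := size_tuple [tuple f i | i < k.+1].
  apply/(pairwiseP (f ord0))/forallP => [H i|H i j].
    apply/forallP => j; apply/implyP => ij.
    wlog ij' : i j ij / (i < j)%N.
      move=> W; case: (ltnP i j) => h; first exact: W.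
      by rewrite adj_sym; apply: W; rewrite 1?eq_sym // ltn_neqAle h eq_sym andbT.
    have := H i j; rewrite !inE szt !ltn_ord => /(_ isT isT ij').
    by rewrite !nth_mktuple.
  rewrite !inE szt => hi hj ij.
  have /forallP/(_ (Ordinal hj)) := H (Ordinal hi).
  rewrite -(inj_eq val_inj) /= (ltn_eqF ij) /=.
  have := nth_mktuple f (f ord0) (Ordinal hi).
  by have := nth_mktuple f (f ord0) (Ordinal hj) => /= -> ->.
exists (fun t => [ffun i => tnth t i]) => [f _|t _].
  by apply/ffunP => i; rewrite ffunE tnth_mktuple.
by apply: eq_from_tnth => i; rewrite tnth_mktuple ffunE.
Qed.

Lemma gnp_expect_cliques (R : realType) (n k : nat) (p : R) :
  \sum_(G : graph n) gnp_mass p G * (cliques k G)%:R =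
  (n ^_ k)%:R * p ^+ 'C(k, 2).
Proof.
under eq_bigr => G _ do rewrite (cliquesE R) mulr_sumr.
rewrite exchange_big /=.
rewrite (eq_bigr (fun t : k.-tuple 'I_n => (uniq t)%:R * p ^+ 'C(k, 2))).
  rewrite -mulr_suml -natr_sum; congr (_%:R * _).
  have := card_uniq_tuples k (xpredT : pred 'I_n).
  rewrite cardT size_enum_ord => <-; rewrite -sum1_card [RHS]big_mkcond /=.
  by apply: eq_bigr => t _; rewrite inE all_predT /=; case: (uniq t).
move=> t _; case: (boolP (uniq t)) => ut.
  rewrite mul1r; under eq_bigr do rewrite clique_wt_pairs.
  rewrite (gnp_indep p (fun b => b%:R) (clique_pairs_neq ut) (clique_pairs_uniq ut)).
  by rewrite mulr1 mulr0 addr0 size_clique_pairs size_tuple.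
(* A repeated vertex would have to be adjacent to itself. *)
rewrite mul0r big1 // => G _; rewrite clique_wt_pairwise.
suff -> : pairwise (adj G) t = false by rewrite mulr0.
apply/negbTE; apply: contraNN ut => h; rewrite uniq_pairwise.
by apply: sub_pairwise h => x y; exact: adj_neq.
Qed.

Lemma box4E (R : realFieldType) (V : finType) (g : V -> V -> R) :
  box4 g = \sum_u \sum_v \sum_y \sum_z g u y * g u z * g v y * g v z.
Proof.
pose f (b a : V * V) := g b.1 a.1 * g b.1 a.2 * g b.2 a.1 * g b.2 a.2.
transitivity (\sum_a \sum_b f b a).
  rewrite -(pair_bigA _ (fun y z => \sum_b f b (y, z))) /=.
  do 2![apply: eq_bigr => ? _].
  rewrite expr2 big_distrlr -(pair_bigA _ (fun u v => f (u, v) _)) /=.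
  by do 2![apply: eq_bigr => ? _]; rewrite /f /=; ring.
rewrite exchange_big -(pair_bigA _ (fun u v => \sum_a f (u, v) a)) /=.
do 2![apply: eq_bigr => ? _].
by rewrite -(pair_bigA _ (fun y z => f _ (y, z))).
Qed.

(** For distinct [u, v, y, z] the four entries are distinct edges of a 4-cycle, independent with
    mean [p - q]. Any other term is at most 1, and each of the six possible coincidences accounts
    for [n^3] quadruples. *)
Lemma gnp_expect_box4 (R : realType) (n : nat) (p q : R) :
  0 <= p <= 1 -> 0 <= q <= 1 ->
  \sum_(G : graph n) gnp_mass p G * box4 (fun x y => adjr R G x y - q) <=
  n%:R ^+ 4 * (p - q) ^+ 4 + 6 * n%:R ^+ 3.
Proof.
move=> p01 q01.
pose h (G : graph n) (u v y z : 'I_n) : R := (adjr R G u y - q) *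
  (adjr R G u z - q) * (adjr R G v y - q) * (adjr R G v z - q).
have -> : \sum_(G : graph n) gnp_mass p G * box4 (fun x y => adjr R G x y - q) =
    \sum_u \sum_v \sum_y \sum_z \sum_(G : graph n) gnp_mass p G * h G u v y z.
  transitivity (\sum_(G : graph n) \sum_u \sum_v \sum_y \sum_z
      gnp_mass p G * h G u v y z).
    apply: eq_bigr => G _; rewrite box4E.
    by do 4![rewrite mulr_sumr; apply: eq_bigr => ? _].
  by do 4![rewrite exchange_big /=; apply: eq_bigr => ? _].
(* Counting coincidences with multiplicity gives a union bound whose sum over all quadruples is
   explicit. *)
pose coin (u v y z : 'I_n) : R := (u == v)%:R + (y == z)%:R + (u == y)%:R +
  (u == z)%:R + (v == y)%:R + (v == z)%:R.
apply: (@le_trans _ _ (\sum_(u < n) \sum_(v < n) \sum_(y < n) \sum_(z < n)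
   ((p - q) ^+ 4 + coin u v y z))).
  apply: ler_sum => u _; apply: ler_sum => v _; apply: ler_sum => y _.
  apply: ler_sum => z _.
  have coin0 : 0 <= coin u v y z by rewrite !addr_ge0.
  case: (boolP [&& u != v, y != z, u != y, u != z, v != y & v != z]).
    case/and5P=> uv yz uy uz /andP[vy vz].
    pose L := [:: (u, y); (u, z); (v, y); (v, z)].
    rewrite (_ : \sum_G _ = (p - q) ^+ 4) ?lerDl //.
    have dL : all (fun e => e.1 != e.2) L by rewrite /= uy uz vy vz.
    have uL : uniq (map (@sort_pair n) L).
      have ne (a b c d : 'I_n) : (a, b) != (c, d) -> (a, b) != (d, c) ->
          sort_pair (a, b) != sort_pair (c, d).
        by move=> h1 h2; apply/negP => /eqP/sort_pair_inj[]; exact/eqP.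
      rewrite /= !inE !negb_or !ne // !xpair_eqE !negb_and ?uv ?yz ?uy ?uz ?vy ?vz
        ?orbT //.
    have := gnp_indep p (fun b => b%:R - q) dL uL.
    rewrite (_ : p * (1 - q) + (1 - p) * (0 - q) = p - q); last by ring.
    move<-; apply: eq_bigr => G _.
    by rewrite !big_cons big_nil /h /adjr mulr1 !mulrA.
  move=> nd; have c1 : 1 <= coin u v y z.
    rewrite /coin -!natrD ler1n; move: nd.
    by do 6!(case: eqP => _ //=).
  rewrite (@le_trans _ _ 1) ?lerDr //; last first.
    by rewrite (le_trans c1) // lerDr exprn_even_ge0.
  rewrite -(gnp_mass_sum1 n p); apply: ler_sum => G _.
  rewrite ler_piMr ?gnp_mass_ge0 //.
  apply: le_trans (ler_norm _) _; rewrite !normrM.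
  have g1 (a b : 'I_n) : 0 <= `|adjr R G a b - q| <= 1.
    rewrite normr_ge0 ler_norml /adjr /=; case/andP: q01 => ? ?.
    by case: (adj G a b) => /=; lra.
  by rewrite !mulr_ile1 ?mulr_ge0 //; case/andP: (g1 u y); case/andP: (g1 u z);
     case/andP: (g1 v y); case/andP: (g1 v z).
have S1 (a : 'I_n) : \sum_(b < n) (a == b)%:R = 1 :> R.
  rewrite (bigD1 a) //= eqxx big1 ?addr0 // => b.
  by rewrite eq_sym => /negbTE->.
have cst (c : R) : \sum_(b < n) c = n%:R * c.
  by rewrite sumr_const card_ord mulr_natl.
rewrite le_eqVlt; apply/orP; left; apply/eqP; rewrite /coin.
under eq_bigr => u _.
  under eq_bigr => v _.
    under eq_bigr => y _ do rewrite !big_split /= !cst !S1.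
    rewrite !big_split /= !cst -!mulr_sumr !S1.
    over.
  rewrite !big_split /= !cst -!mulr_sumr !S1.
  over.
rewrite /= !big_split /= !cst.
by ring.
Qed.

Lemma bernoulli_le (R : realFieldType) (x : R) (k : nat) :
  0 <= x <= 1 -> 1 - k%:R * x <= (1 - x) ^+ k.
Proof.
case/andP=> x0 x1; elim: k => [|k IH]; first by rewrite mul0r subr0 expr0.
rewrite exprS -natr1.
have : (1 - x) * (1 - k%:R * x) <= (1 - x) * (1 - x) ^+ k.
  by apply: ler_wpM2l; rewrite ?subr_ge0.
have : 0 <= k%:R * x ^+ 2 by rewrite mulr_ge0 ?sqr_ge0.
by rewrite expr2; nra.
Qed.

Lemma ffact_le_exp (n k : nat) : (n ^_ k <= n ^ k)%N.
Proof.
by elim: k => [|k IH] //; rewrite ffactnSr expnSr leq_mul // leq_subr.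
Qed.

Lemma ffact_ge (R : realFieldType) (n k : nat) : (0 < n)%N -> (k <= n)%N ->
  n%:R ^+ k * (1 - k%:R ^+ 2 / n%:R) <= (n ^_ k)%:R :> R.
Proof.
move=> n0 kn.
have nR : 0 < n%:R :> R by rewrite ltr0n.
have h : ((n - k) ^ k <= n ^_ k)%N.
  elim: k {kn} => [|k IH] //; rewrite ffactnSr expnSr leq_mul // ?leq_sub2l //.
  by apply: leq_trans IH; case: k => // k; rewrite leq_exp2r // leq_sub2l.
apply: (@le_trans _ _ ((n - k) ^ k)%:R); last by rewrite ler_nat.
rewrite natrX natrB //.
have -> : n%:R - k%:R = n%:R * (1 - k%:R / n%:R) :> R.
  by field; rewrite gt_eqF.
rewrite exprMn; apply: ler_wpM2l; first by rewrite exprn_ge0.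
apply: le_trans (bernoulli_le _ _); first by rewrite expr2 mulrA.
by rewrite divr_ge0 //= ler_pdivrMr // mul1r ler_nat.
Qed.

(** * Expectations of randomized programs *)

Fixpoint expect (R : realType) (n : nat) (X : Type) (A : ralg R n X)
  (G : graph n) (f : X -> R) : R :=
  match A with
  | Output x => f x
  | Query u v h => expect (h (adj G u v)) G f
  | Draw m mu h => \sum_(i < m) mu i * expect (h i) G f
  end.

Lemma pr_outputE (R : realType) (n : nat) (X : eqType) (A : ralg R n X)
    (G : graph n) (y : X) :
  pr_output A G y = expect A G (fun x => (x == y)%:R).
Proof.
by elim: A => //= m mu h IH; apply: eq_bigr => i _; rewrite IH.
Qed.

Lemma pr_output_ge0 (R : realType) (n : nat) (X : eqType) (A : ralg R n X)
    (G : graph n) (y : X) : 0 <= pr_output A G y.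
Proof.
by elim: A => //= m mu h IH; apply: sumr_ge0 => i _; rewrite mulr_ge0 ?mass_ge0.
Qed.

Lemma pr_output_sum1 (R : realType) (n : nat) (X : finType) (A : ralg R n X)
    (G : graph n) : \sum_y pr_output A G y = 1.
Proof.
elim: A => [x|u v h IH|m mu h IH] /=; last 2 first.
- exact: IH.
- rewrite exchange_big /= -[RHS](mass_sum1 mu).
  by apply: eq_bigr => i _; rewrite -mulr_sumr IH mulr1.
- rewrite (bigD1 x) //= eqxx big1 ?addr0 // => y.
  by rewrite eq_sym => /negbTE->.
Qed.

(** A command makes at most one query, so a running time bounds the queries; this lets the program
    for (2) serve (1). *)
Lemma queries_exec (R : realType) (n W t : nat) (s : seq cmd) (m : memory) :
  (queries (exec R n W t s m) <= t)%N.
Proof.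
elim: t s m => [|t IH] [|c s] m //=.
case: c => [|a e|a u v|a e|c1 c2|e c1 c2|e c1] /=; try exact: leqW (IH _ _).
- case: insubP => [i _ _|_]; last exact: leqW.
  case: insubP => [j _ _|_]; last exact: leqW.
  by rewrite /= ltnS geq_max !IH.
- case: (eval W m e) => [|r]; first exact: leqW.
  by apply/bigmax_leqP => i _; exact: leqW.
Qed.

Fixpoint ralg_map (R : realType) (n : nat) (X Y : Type) (h : X -> Y)
  (A : ralg R n X) : ralg R n Y :=
  match A with
  | Output x => Output (h x)
  | Query u v f => Query u v (fun b => ralg_map h (f b))
  | Draw m mu f => Draw mu (fun i => ralg_map h (f i))
  end.

Lemma queries_map (R : realType) (n : nat) (X Y : Type) (h : X -> Y)
    (A : ralg R n X) : queries (ralg_map h A) = queries A.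
Proof.
elim: A => //= [u v f IH|m mu f IH]; first by rewrite !IH.
by apply: eq_bigr => i _; rewrite IH.
Qed.

Lemma expect_map (R : realType) (n : nat) (X Y : Type) (h : X -> Y)
    (A : ralg R n X) (G : graph n) (f : Y -> R) :
  expect (ralg_map h A) G f = expect A G (f \o h).
Proof.
by elim: A => //= m mu g IH; apply: eq_bigr => i _; rewrite IH.
Qed.

(** * The sampling program and its execution on the word RAM *)

Definition cell (a : nat) : expr := Cell (Const a).

Definition epow (e : expr) (m : nat) : expr := iter m (Bin OpMul e) (Const 1).

Local Notation "a +e b" := (Bin OpAdd a b) (at level 50, left associativity).
Local Notation "a *e b" := (Bin OpMul a b) (at level 40, left associativity).

(* Cell 0 holds n, cell 1 holds P, cells 11 to 14 four entries of the adjacency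
   matrix; the difference of the two expressions is n^4 plus the product of the
   four numbers n * entry - P. It is split because subtraction is truncated. *)
Definition box_pos : expr :=
  epow (cell 0) 4 +e
  (cell 11 *e cell 12 *e epow (cell 0) 2 +e epow (cell 1) 2) *e
  (cell 13 *e cell 14 *e epow (cell 0) 2 +e epow (cell 1) 2) +e
  ((cell 11 +e cell 12) *e cell 0 *e cell 1) *e
  ((cell 13 +e cell 14) *e cell 0 *e cell 1).

Definition box_neg : expr :=
  (cell 11 *e cell 12 *e epow (cell 0) 2 +e epow (cell 1) 2) *e
  ((cell 13 +e cell 14) *e cell 0 *e cell 1) +e
  ((cell 11 +e cell 12) *e cell 0 *e cell 1) *e
  (cell 13 *e cell 14 *e epow (cell 0) 2 +e epow (cell 1) 2).

Definition store (a : nat) (e : expr) : cmd := Store (Const a) e.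

Definition loop_body : cmd :=
  foldr Seq (store 4 (Bin OpSub (cell 4) (Const 1)))
  [:: Rnd (Const 7) (cell 0); Rnd (Const 8) (cell 0);
      Rnd (Const 9) (cell 0); Rnd (Const 10) (cell 0);
      Ask (Const 11) (cell 7) (cell 9); Ask (Const 12) (cell 7) (cell 10);
      Ask (Const 13) (cell 8) (cell 9); Ask (Const 14) (cell 8) (cell 10);
      store 15 box_pos; store 16 box_neg;
      store 6 (cell 6 +e Bin OpSub (cell 15) (cell 16))].

Definition loop : cmd := While (cell 4) loop_body.

Definition finish : cmd := store 0 (Bin OpLt (cell 6) (cell 5)).

(* Cell 2 holds r, about 1 / p; cell 3 holds K = D r^m; cell 4 counts the
   remaining samples, initially 100 K^2; cell 5 holds the rejection threshold
   and cell 6 the sum of n^4 (1 + Z) over the samples, where Z is the product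
   g(u,y) g(u,z) g(v,y) g(v,z). *)
Definition box_tester (D m : nat) : cmd :=
  foldr Seq finish
  [:: store 2 (Bin OpDiv (cell 0) (cell 1) +e Const 1);
      store 3 (Const D *e epow (cell 2) m);
      store 4 (Const 100 *e (cell 3 *e cell 3));
      store 5 ((cell 4 +e Const 50 *e cell 3) *e epow (cell 0) 4);
      loop].

Definition upd (m : memory) (a x : nat) : memory :=
  fun b => if b == a then x else m b.

Section Execution.
Variables (R : realType) (n' W : nat).
Local Notation n := n'.+1.
Variables (G : graph n) (f : option bool -> R).
Hypothesis W_big : (100 < W)%N.

Local Notation run_from t s m := (expect (exec R n W t s m) G f).

Lemma eval_cell (m : memory) (a : nat) : (a <= 100)%N -> eval W m (cell a) = m a.
Proof. by move=> ha; rewrite /= modn_small // (leq_ltn_trans ha). Qed.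

Lemma eval_bin (m : memory) (o : wop) (a b : expr) :
  eval W m (Bin o a b) = (apply_op o (eval W m a) (eval W m b) %% W)%N.
Proof. by []. Qed.

(* The value of an expression when sums and products are not reduced modulo
   [W]. *)
Fixpoint ring_val (m : memory) (e : expr) : nat :=
  match e with
  | Const c => c
  | Bin OpAdd a b => ring_val m a + ring_val m b
  | Bin OpMul a b => ring_val m a * ring_val m b
  | e' => eval W m e'
  end.

(** Reduction modulo [W] commutes with sums and products, so only the final value of a polynomial
    expression has to fit in a word. *)
Lemma eval_ring_val (m : memory) (e : expr) :
  (eval W m e = ring_val m e %[mod W])%N.
Proof.
elim: e => [c|a _|o a IHa b IHb]; [exact: modn_mod|by []|].
case: o => //; rewrite eval_bin /= modn_mod.
- by rewrite -modnDm IHa IHb modnDm.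
- by rewrite -modnMm IHa IHb modnMm.
Qed.

Lemma eval_bin_ring (m : memory) (o : wop) (a b : expr) :
  (ring_val m (Bin o a b) < W)%N -> eval W m (Bin o a b) = ring_val m (Bin o a b).
Proof. by move=> h; rewrite -(modn_small h) -eval_ring_val modn_mod. Qed.

Lemma expect_seq t c1 c2 s m :
  run_from t.+1 (Seq c1 c2 :: s) m = run_from t (c1 :: c2 :: s) m.
Proof. by []. Qed.

Lemma expect_store t a e s m x :
  (a <= 100)%N -> eval W m e = x -> (x < W)%N ->
  run_from t.+1 (store a e :: s) m = run_from t s (upd m a x).
Proof.
move=> ha <- hx; rewrite /= modn_small ?(leq_ltn_trans ha) //.
by rewrite /write /upd modn_small.
Qed.

Lemma expect_ask t a u v s m (i j : 'I_n) :
  (a <= 100)%N -> eval W m u = i -> eval W m v = j ->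
  run_from t.+1 (Ask (Const a) u v :: s) m =
  run_from t s (upd m a (adj G i j)).
Proof.
move=> ha ui vj; rewrite /= ui vj !valK /= modn_small ?(leq_ltn_trans ha) //.
rewrite /write /upd modn_small //; apply: leq_trans W_big.
by case: (adj G i j).
Qed.

Lemma expect_rnd t a e s m :
  (a <= 100)%N -> (n < W)%N -> eval W m e = n ->
  run_from t.+1 (Rnd (Const a) e :: s) m =
  \sum_(i < n) n%:R^-1 * run_from t s (upd m a i).
Proof.
move=> ha hn en; rewrite /= en /= modn_small ?(leq_ltn_trans ha) //.
apply: eq_bigr => i _; rewrite /write /upd modn_small //.
exact: ltn_trans (ltn_ord i) hn.
Qed.

(** The increment of the accumulator in unbounded arithmetic, split into positive and negative terms
    like [box_pos] and [box_neg]. *)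
Definition box_inc (P : nat) (a b c d : bool) : nat :=
  (n ^ 4 + (a * b * n ^ 2 + P ^ 2) * (c * d * n ^ 2 + P ^ 2) +
   ((a + b) * n * P) * ((c + d) * n * P) -
   ((a * b * n ^ 2 + P ^ 2) * ((c + d) * n * P) +
    ((a + b) * n * P) * (c * d * n ^ 2 + P ^ 2)))%N.

Definition avg4 (F : 'I_n -> 'I_n -> 'I_n -> 'I_n -> R) : R :=
  \sum_u n%:R^-1 * \sum_v n%:R^-1 * \sum_y n%:R^-1 * \sum_z n%:R^-1 * F u v y z.

(** The expectation of [f] over the last [i] rounds: the rest of the run depends on the memory only
    through the counter and the accumulator. *)
Fixpoint loop_value (P Th i acc : nat) : R :=
  if i is i'.+1 then
    avg4 (fun u v y z => loop_value P Th i'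
      (acc + box_inc P (adj G u y) (adj G u z) (adj G v y) (adj G v z)))
  else f (Some (acc < Th)%N).

Lemma eq_avg4 (F F' : 'I_n -> 'I_n -> 'I_n -> 'I_n -> R) :
  (forall u v y z, F u v y z = F' u v y z) -> avg4 F = avg4 F'.
Proof.
move=> E; rewrite /avg4.
do 4![apply: eq_bigr => ? _; congr (_ * _)]; exact: E.
Qed.

(** Every factor is at most [2 n^2], so both parts stay below the word modulus. *)
Lemma box_inc_le (P : nat) (a b c d : bool) : (P <= n)%N ->
  (n ^ 4 + (a * b * n ^ 2 + P ^ 2) * (c * d * n ^ 2 + P ^ 2) +
   ((a + b) * n * P) * ((c + d) * n * P) <= 9 * n ^ 4)%N /\
   ((a * b * n ^ 2 + P ^ 2) * ((c + d) * n * P) +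
    ((a + b) * n * P) * (c * d * n ^ 2 + P ^ 2) <= 8 * n ^ 4)%N.
Proof.
move=> Pn.
have h1 (x y : bool) : (x * y * n ^ 2 + P ^ 2 <= 2 * n ^ 2)%N.
  rewrite mulSn mul1n leq_add ?leq_exp2r //.
  by case: x; case: y; rewrite ?mul1n ?mul0n ?muln0.
have h2 (x y : bool) : ((x + y) * n * P <= 2 * n ^ 2)%N.
  rewrite -mulnA (expnS n 1) expn1 leq_mul // ?leq_mul //.
  by case: x; case: y.
have e4 : (n ^ 4 = n ^ 2 * n ^ 2)%N by rewrite -expnD.
have := leq_mul (h1 a b) (h1 c d); have := leq_mul (h2 a b) (h2 c d).
have := leq_mul (h1 a b) (h2 c d); have := leq_mul (h2 a b) (h1 c d).
by rewrite e4; lia.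
Qed.

(** A round takes 24 steps: one loop test, eleven [Seq] and twelve commands. The 2 is for the
    failing test and [finish]. A round adds at most [9 n^4] to [acc], so the bound by [W] is
    preserved with one round fewer to go. *)
Lemma expect_loop (P Th i acc : nat) (m : memory) :
  (P <= n)%N -> (9 * n ^ 4 * i.+1 + acc < W)%N -> (i < W)%N -> (Th < W)%N ->
  m 0%N = n -> m 1%N = P -> m 4%N = i -> m 5%N = Th -> m 6%N = acc ->
  run_from (24 * i + 2) [:: loop; finish] m = loop_value P Th i acc.
Proof.
move=> Pn; elim: i acc m => [|i IH] acc m accW iW ThW m0 m1 m4 m5 m6.
  rewrite muln0 add0n.
  have -> : run_from 2%N [:: loop; finish] m = run_from 1%N [:: finish] m.
    by rewrite /= modn_small ?m4 // (leq_ltn_trans _ W_big).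
  rewrite (@expect_store _ _ _ _ _ (acc < Th)%N) //.
  - by rewrite /upd /=; case: (acc < Th)%N.
  - rewrite eval_bin !eval_cell // m6 m5 modn_small //= (leq_ltn_trans _ W_big) //.
    exact: leq_trans (leq_b1 _) _.
  - by rewrite (leq_ltn_trans _ W_big) //; exact: leq_trans (leq_b1 _) _.
have nW : (n < W)%N.
  have : (n ^ 1 <= n ^ 4)%N by rewrite leq_pexp2l.
  by move: accW; rewrite expn1 mulnS; lia.
have -> : (24 * i.+1 + 2)%N = (24 * i + 2).+4.+4.+4.+4.+4.+4 by lia.
have -> t : run_from t.+1 [:: loop; finish] m =
    run_from t [:: loop_body; loop; finish] m.
  by rewrite [in LHS]/= modn_small ?m4 // (leq_ltn_trans _ W_big).
rewrite /loop_body /foldr.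
rewrite expect_seq expect_rnd //; last by rewrite eval_cell.
rewrite /loop_value -/loop_value /avg4; apply: eq_bigr => u _; congr (_ * _).
rewrite expect_seq expect_rnd //; last by rewrite eval_cell.
apply: eq_bigr => v _; congr (_ * _).
rewrite expect_seq expect_rnd //; last by rewrite eval_cell.
apply: eq_bigr => y _; congr (_ * _).
rewrite expect_seq expect_rnd //; last by rewrite eval_cell.
apply: eq_bigr => z _; congr (_ * _).
rewrite expect_seq (@expect_ask _ _ _ _ _ _ u y) //; try by rewrite eval_cell.
rewrite expect_seq (@expect_ask _ _ _ _ _ _ u z) //; try by rewrite eval_cell.
rewrite expect_seq (@expect_ask _ _ _ _ _ _ v y) //; try by rewrite eval_cell.
rewrite expect_seq (@expect_ask _ _ _ _ _ _ v z) //; try by rewrite eval_cell.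
set a := adj G u y; set b := adj G u z; set c := adj G v y; set d := adj G v z.
set mm := upd _ 14 _.
have mm0 : mm 0%N = n by rewrite /mm /upd /= m0.
have mm1 : mm 1%N = P by rewrite /mm /upd /= m1.
have mm4 : mm 4%N = i.+1 by rewrite /mm /upd /= m4.
have mm5 : mm 5%N = Th by rewrite /mm /upd /= m5.
have mm6 : mm 6%N = acc by rewrite /mm /upd /= m6.
have mm11 : mm 11%N = a by [].
have mm12 : mm 12%N = b by [].
have mm13 : mm 13%N = c by [].
have mm14 : mm 14%N = d by [].
move: mm mm0 mm1 mm4 mm5 mm6 mm11 mm12 mm13 mm14 => mm.
move=> mm0 mm1 mm4 mm5 mm6 mm11 mm12 mm13 mm14.
have [hpos hneg] := box_inc_le a b c d Pn.
have [big1' big2'] : (9 * n ^ 4 < W)%N /\ (8 * n ^ 4 < W)%N.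
  by move: accW; rewrite mulnS; lia.
set pos := (X in (X <= 9 * _)%N) in hpos.
set neg := (X in (X <= 8 * _)%N) in hneg.
have incE : box_inc P a b c d = (pos - neg)%N by [].
have cellE (m0' : memory) (x : nat) : (x <= 100)%N -> m0' (x %% W)%N = m0' x.
  exact: eval_cell.
rewrite expect_seq (@expect_store _ _ _ _ _ pos) //; first last.
- exact: leq_ltn_trans hpos big1'.
- have E : ring_val mm box_pos = pos.
    by rewrite /= !cellE // mm0 mm1 mm11 mm12 mm13 mm14 /pos; lia.
  by rewrite -E eval_bin_ring // -/box_pos E (leq_ltn_trans hpos).
rewrite expect_seq (@expect_store _ _ _ _ _ neg) //; first last.
- exact: leq_ltn_trans hneg big2'.
- set m' := upd mm _ _.
  have E : ring_val m' box_neg = neg.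
    by rewrite /= !cellE // /m' /upd /= mm0 mm1 mm11 mm12 mm13 mm14 /neg; lia.
  by rewrite -E eval_bin_ring // -/box_neg E (leq_ltn_trans hneg).
have accW' : (acc + (pos - neg) < W)%N.
  by apply: leq_ltn_trans accW; move: hpos; rewrite mulnS; lia.
rewrite expect_seq (@expect_store _ _ _ _ _ (acc + (pos - neg))%N) //; first last.
- rewrite !eval_bin /apply_op !eval_cell // /upd /= mm6 modnDmr modn_small //.
rewrite (@expect_store _ _ _ _ _ i) //; first last.
- exact: ltn_trans iW.
- rewrite !eval_bin /apply_op !eval_cell // /upd /= mm4.
  rewrite (@modn_small 1) ?(leq_ltn_trans _ W_big) // subn1.
  by rewrite modn_small // (ltn_trans _ iW).
apply: IH => //.
- by apply: leq_ltn_trans accW; move: hpos; rewrite incE !mulnS; lia.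
- exact: ltn_trans iW.
Qed.

(** The 11 is the 2 of the loop, plus four [Seq], four stores and the [Seq] in front of the loop. *)
Lemma expect_box_tester (D k P : nat) (m : memory) :
  let K := (D * (n %/ P + 1) ^ k)%N in
  let N := (100 * (K * K))%N in
  let Th := ((N + 50 * K) * n ^ 4)%N in
  (P <= n)%N -> (0 < D)%N -> (9 * n ^ 4 * N.+1 < W)%N -> (Th < W)%N ->
  (n %/ P + 1 < W)%N -> m 0%N = n -> m 1%N = P -> m 6%N = 0%N ->
  run_from (24 * N + 11) [:: box_tester D k] m = loop_value P Th N 0.
Proof.
move=> K N Th Pn D0 NW ThW rW m0 m1 m6.
have K0 : (0 < K)%N by rewrite muln_gt0 D0 expn_gt0 addn1.
have NleW : (N < W)%N.
  by apply: leq_ltn_trans NW; rewrite (@leq_trans N.+1) ?leq_pmull.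
have KW : (K < W)%N.
  apply: leq_ltn_trans NleW; rewrite (leq_trans (leq_pmulr K K0)) //.
  by rewrite leq_pmull.
have cellE (m' : memory) (x : nat) : (x <= 100)%N -> m' (x %% W)%N = m' x.
  exact: eval_cell.
rewrite (_ : 24 * N + 11 = (24 * N + 2).+1.+4.+4)%N; last by lia.
rewrite /box_tester /foldr.
rewrite expect_seq (@expect_store _ _ _ _ _ (n %/ P + 1)%N) //; last first.
  rewrite !eval_bin /apply_op !eval_cell // m0 m1 -[eval W m (Const 1)]/(1 %% W)%N.
  by rewrite modnDm modn_small.
set mr := upd m 2 _.
have powE : ring_val mr (epow (cell 2) k) = ((n %/ P + 1) ^ k)%N.
  by elim: k {K N Th K0 NleW KW NW ThW} => //= k ->; rewrite cellE // expnS.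
rewrite expect_seq (@expect_store _ _ _ _ _ K) //; last first.
  have E : ring_val mr (Const D *e epow (cell 2) k) = K by rewrite /= powE.
  by rewrite eval_bin_ring E.
rewrite expect_seq (@expect_store _ _ _ _ _ N) //; last first.
  set mK := upd mr _ _.
  have E : ring_val mK (Const 100 *e (cell 3 *e cell 3)) = N by rewrite /= !cellE.
  by rewrite eval_bin_ring E.
rewrite expect_seq (@expect_store _ _ _ _ _ Th) //; last first.
  set mN := upd _ 4 _.
  have E : ring_val mN ((cell 4 +e Const 50 *e cell 3) *e epow (cell 0) 4) = Th.
    rewrite /Th (_ : n ^ 4 = n * (n * (n * (n * 1))))%N; last by lia.
    by rewrite /= !cellE // /mN /mr /upd /= m0.
  by rewrite eval_bin_ring E.
rewrite expect_seq; apply: expect_loop => //.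
by rewrite addn0.
Qed.

Lemma avg4E (F : 'I_n -> 'I_n -> 'I_n -> 'I_n -> R) :
  avg4 F = n%:R^-1 ^+ 4 *
    \sum_(a : ('I_n * 'I_n) * ('I_n * 'I_n)) F a.1.1 a.1.2 a.2.1 a.2.2.
Proof.
rewrite -(pair_bigA _ (fun b c : 'I_n * 'I_n => F b.1 b.2 c.1 c.2)) /=.
rewrite -(pair_bigA _ (fun u v => \sum_c F u v c.1 c.2)) /=.
rewrite mulr_sumr /avg4; apply: eq_bigr => u _.
rewrite mulr_sumr [RHS]mulr_sumr; apply: eq_bigr => v _.
rewrite -(pair_bigA _ (fun y z => F u v y z)) /=.
rewrite !mulr_sumr; apply: eq_bigr => y _.
by rewrite !mulr_sumr; apply: eq_bigr => z _; ring.
Qed.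

Lemma ler_avg4 (F F' : 'I_n -> 'I_n -> 'I_n -> 'I_n -> R) :
  (forall u v y z, F u v y z <= F' u v y z) -> avg4 F <= avg4 F'.
Proof.
move=> h; rewrite !avg4E ler_wpM2l ?exprn_ge0 ?invr_ge0 //.
by apply: ler_sum => a _.
Qed.

Lemma avg4_cst (c : R) : avg4 (fun _ _ _ _ => c) = c.
Proof.
rewrite avg4E sumr_const !card_prod card_ord -[c *+ _]mulr_natl !natrM.
by field; rewrite ?pnatr_eq0.
Qed.

Lemma avg4D (F F' : 'I_n -> 'I_n -> 'I_n -> 'I_n -> R) :
  avg4 (fun u v y z => F u v y z + F' u v y z) = avg4 F + avg4 F'.
Proof. by rewrite !avg4E big_split mulrDr. Qed.

Lemma avg4Z (c : R) (F : 'I_n -> 'I_n -> 'I_n -> 'I_n -> R) :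
  avg4 (fun u v y z => c * F u v y z) = c * avg4 F.
Proof. by rewrite !avg4E -mulr_sumr mulrCA. Qed.

Definition box_term (q : R) (u v y z : 'I_n) : R :=
  (adjr R G u y - q) * (adjr R G u z - q) *
  (adjr R G v y - q) * (adjr R G v z - q).

Lemma avg4_box_term (q : R) :
  avg4 (box_term q) = box4 (fun x y => adjr R G x y - q) / n%:R ^+ 4.
Proof.
rewrite avg4E exprVn mulrC; congr (_ / _); rewrite box4E.
rewrite -(pair_bigA _ (fun b c : 'I_n * 'I_n => box_term q b.1 b.2 c.1 c.2)) /=.
rewrite -(pair_bigA _ (fun u v => \sum_c box_term q u v c.1 c.2)) /=.
do 2![apply: eq_bigr => ? _].
by rewrite -(pair_bigA _ (fun y z => box_term q _ _ y z)).
Qed.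

(** As [0 <= P <= n], each factor [n * entry - P] has absolute value at most [n]; the product is at
    least [- n^4], so the truncated subtraction is exact. *)
Lemma box_incE (P : nat) (a b c d : bool) : (P <= n)%N ->
  (box_inc P a b c d)%:R = n%:R ^+ 4 * (1 + (a%:R - P%:R / n%:R) *
    (b%:R - P%:R / n%:R) * (c%:R - P%:R / n%:R) * (d%:R - P%:R / n%:R)) :> R.
Proof.
move=> Pn; have n0 : n%:R != 0 :> R by rewrite pnatr_eq0.
set X : R := n%:R; set Y : R := P%:R.
have YX : 0 <= Y <= X by rewrite ler0n ler_nat.
have hx (e : bool) : `|e%:R * X - Y| <= X.
  by rewrite ler_norml; case/andP: YX => *; case: e; rewrite /= ?mul1r ?mul0r; lra.
have lb : - X ^+ 4 <=
    (a%:R * X - Y) * (b%:R * X - Y) * ((c%:R * X - Y) * (d%:R * X - Y)).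
  suff : `|(a%:R * X - Y) * (b%:R * X - Y) * ((c%:R * X - Y) * (d%:R * X - Y))|
      <= X ^+ 4 by rewrite ler_norml => /andP[].
  rewrite !normrM (_ : X ^+ 4 = (X * X) * (X * X)); last by ring.
  by rewrite !ler_pM ?mulr_ge0.
rewrite /box_inc natrB; last first.
  rewrite -(ler_nat R) !(natrD, natrM, natrX) -/X -/Y -subr_ge0.
  move: lb; rewrite -subr_ge0 opprK; congr (is_true (_ <= _)).
  by ring.
rewrite !(natrD, natrM, natrX) -/X -/Y.
by field; rewrite ?pnatr_eq0.
Qed.

(* Chebyshev's inequality for the sum of the samples, as a supermartingale
   bound along the loop. *)
Lemma loop_value_chebyshev (P Th i acc : nat) (tau c : R) :
  let mu := avg4 (box_term (P%:R / n%:R)) in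
  (P <= n)%N -> 0 < c ->
  (forall a : nat, f (Some (a < Th)%N) <= (a%:R / n%:R ^+ 4 - tau) ^+ 2 / c) ->
  loop_value P Th i acc <=
    ((acc%:R / n%:R ^+ 4 + i%:R * (1 + mu) - tau) ^+ 2 + i%:R) / c.
Proof.
move=> mu Pn c0 hf; have ic0 : 0 <= c^-1 by rewrite invr_ge0 ltW.
elim: i acc => [|i IH] acc.
  by rewrite mul0r !addr0; exact: hf.
rewrite /loop_value -/loop_value.
set B := acc%:R / n%:R ^+ 4 + i.+1%:R * (1 + mu) - tau.
set q : R := P%:R / n%:R.
have q01 : 0 <= q <= 1.
  by rewrite divr_ge0 //= ler_pdivrMr ?ltr0n // mul1r ler_nat.
have n0 : n%:R != 0 :> R by rewrite pnatr_eq0.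
(* Expand the square of [B + (Z - mu)] and bound [Z ^+ 2] by 1. The rest is affine in [Z], so its
   average is explicit and falls short of the target by [mu ^+ 2 / c]. *)
apply: (@le_trans _ _ (avg4 (fun u v y z =>
   (B ^+ 2 - 2 * B * mu + i%:R + 1) / c + (2 * (B - mu) / c) * box_term q u v y z
   + mu ^+ 2 / c))).
  apply: ler_avg4 => u v y z; apply: le_trans (IH _) _.
  rewrite natrD box_incE // -/q.
  rewrite -[_ * _ * _ * _]/(box_term q u v y z).
  set Z := box_term q u v y z.
  have -> : (acc%:R + n%:R ^+ 4 * (1 + Z)) / n%:R ^+ 4 + i%:R * (1 + mu) - tau =
      B + (Z - mu).
    by rewrite /B -natr1; field.
  have Z1 : Z ^+ 2 <= 1.
    have g1 (a b : 'I_n) : 0 <= `|adjr R G a b - q| <= 1.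
      rewrite normr_ge0 ler_norml /adjr /=; case/andP: q01 => ? ?.
      by case: (adj G a b) => /=; lra.
    rewrite -[Z ^+ 2]real_normK ?num_real // expr_le1 // /Z /box_term !normrM.
    by rewrite !mulr_ile1 ?mulr_ge0 //; case/andP: (g1 u y); case/andP: (g1 u z);
     case/andP: (g1 v y); case/andP: (g1 v z).
  rewrite [2 * (B - mu) / c * Z]mulrAC -!mulrDl ler_wpM2r //.
  rewrite -subr_ge0 (_ : _ - _ = 1 - Z ^+ 2) ?subr_ge0 //.
  by ring.
rewrite 2!avg4D !avg4_cst avg4Z -/mu [_ / c * mu]mulrAC -!mulrDl ler_wpM2r //.
rewrite -subr_ge0 -natr1 (_ : _ - _ = mu ^+ 2) ?sqr_ge0 //.
by ring.
Qed.

End Execution.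

(** * Planted cliques *)

Lemma pr_output_le1 (R : realType) (n : nat) (X : eqType) (A : ralg R n X)
    (G : graph n) (y : X) : pr_output A G y <= 1.
Proof.
elim: A => [x|u v h IH|m mu h IH] //=; first by case: (x == y).
rewrite -(mass_sum1 mu); apply: ler_sum => i _.
by rewrite ler_piMr ?mass_ge0.
Qed.

Definition in_class (n m j : nat) (u v : 'I_n) : bool :=
  ((u %% m == j) && (v %% m == j))%N.

Definition planted (n m j : nat) (G : graph n) : graph n :=
  (G :|: [set e : vpair n | in_class m j (val e).1 (val e).2])%SET.

Lemma adj_planted (n m j : nat) (G : graph n) (u v : 'I_n) :
  ~~ in_class m j u v -> adj (planted m j G) u v = adj G u v.
Proof.
move=> nc; have nc' : ~~ in_class m j v u by rewrite /in_class andbC.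
apply: eq_existsb => e; rewrite !inE.
case: eqP => [E|_] /=; first by rewrite E (negbTE nc) orbF.
case: eqP => [E|_] /=; last by rewrite !andbF.
by rewrite E (negbTE nc') orbF.
Qed.

Lemma adj_planted_class (n m j : nat) (G : graph n) (u v : 'I_n) :
  in_class m j u v -> u != v -> adj (planted m j G) u v.
Proof.
wlog uv : u v / (u < v)%N.
  move=> W c ne; case: (ltnP u v) => h; first exact: W.
  rewrite adj_sym; apply: W; rewrite 1?eq_sym //.
    by rewrite ltn_neqAle h eq_sym andbT.
  by rewrite /in_class andbC.
move=> c _; have := adj_vpair (planted m j G) (Sub (u, v) uv : vpair n).
by rewrite SubK /= => ->; rewrite !inE SubK c orbT.
Qed.

(** The expected number of queries with both ends in class [j], in the run on the unmodified graph
    [G]. *)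
Fixpoint class_hits (R : realType) (n : nat) (X : Type) (m j : nat)
  (A : ralg R n X) (G : graph n) : R :=
  match A with
  | Output _ => 0
  | Query u v h => (in_class m j u v)%:R + class_hits m j (h (adj G u v)) G
  | Draw _ mu h => \sum_i mu i * class_hits m j (h i) G
  end.

Lemma class_hits_ge0 (R : realType) (n : nat) (X : Type) (m j : nat)
    (A : ralg R n X) (G : graph n) : 0 <= class_hits m j A G.
Proof.
elim: A => //= [u v h IH|l mu h IH]; first by rewrite addr_ge0.
by apply: sumr_ge0 => i _; rewrite mulr_ge0 ?mass_ge0.
Qed.

(** The runs on [G] and on the planted graph agree until a query falls inside the class, and the
    probability of that is at most the expected number of such queries. *)
Lemma pr_output_planted (R : realType) (n : nat) (X : eqType) (m j : nat)
    (A : ralg R n X) (G : graph n) (y : X) :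
  pr_output A G y <= pr_output A (planted m j G) y + class_hits m j A G.
Proof.
elim: A => [x|u v h IH|l mu h IH] /=; first by rewrite addr0.
  case: (boolP (in_class m j u v)) => c; last by rewrite add0r adj_planted.
  apply: le_trans (pr_output_le1 _ _ _) _.
  by rewrite addrCA lerDl addr_ge0 ?pr_output_ge0 ?class_hits_ge0.
rewrite -big_split /=; apply: ler_sum => i _.
by rewrite -mulrDr ler_wpM2l ?mass_ge0.
Qed.

(** Residue classes are disjoint, so a query falls inside at most one of them. *)
Lemma sum_class_hits (R : realType) (n : nat) (X : Type) (m : nat)
    (A : ralg R n X) (G : graph n) :
  \sum_(j < m) class_hits m j A G <= (queries A)%:R.
Proof.
elim: A => [x|u v h IH|l mu h IH] /=; first by rewrite big1.
  rewrite big_split /= -natr1 addrC lerD //.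
    apply: le_trans (IH _) _; rewrite ler_nat.
    by case: (adj G u v); rewrite leq_max leqnn ?orbT.
  case: m {IH} => [|m]; first by rewrite big_ord0.
  rewrite (bigD1 (inord (u %% m.+1))) //= big1 ?addr0; last first.
    move=> j; rewrite -(inj_eq val_inj) /= inordK ?ltn_mod // /in_class eq_sym.
    by move/negbTE->.
  by case: (in_class _ _ _ _).
rewrite exchange_big /=.
apply: (@le_trans _ _ (\sum_(i < l) mu i * (\max_(i < l) queries (h i))%:R)).
  apply: ler_sum => i _; rewrite -mulr_sumr ler_wpM2l ?mass_ge0 //.
  by apply: le_trans (IH i) _; rewrite ler_nat (leq_bigmax i).
by rewrite -mulr_suml mass_sum1 mul1r.
Qed.

(** Cut the class into [k] blocks of [s] vertices and take the [i]-th vertex from the [i]-th block: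
    distinctness is automatic, and the count is a pure power. *)
Lemma cliques_planted (n m s k : nat) (j : 'I_m) (G : graph n) :
  (k * s * m <= n)%N -> (s ^ k <= cliques k (planted m j G))%N.
Proof.
move=> ksm.
have lt_n (i : 'I_k) (a : 'I_s) : ((i * s + a) * m + j < n)%N.
  apply: leq_trans ksm; have := ltn_ord i; have := ltn_ord a; have := ltn_ord j.
  move=> hj ha hi.
  have h1 : (i * s + a < k * s)%N.
    apply: (@leq_trans (i.+1 * s)); last by rewrite leq_mul2r hi orbT.
    by rewrite mulSn addnC ltn_add2r.
  apply: (@leq_trans ((i * s + a).+1 * m)); last by rewrite leq_mul2r h1 orbT.
  by rewrite mulSn addnC ltn_add2r.
pose F (h : {ffun 'I_k -> 'I_s}) : {ffun 'I_k -> 'I_n} :=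
  [ffun i => Ordinal (lt_n i (h i))].
have m0 : (0 < m)%N by exact: leq_ltn_trans (ltn_ord j).
have dec (i i' : 'I_k) (a a' : 'I_s) :
    ((i * s + a) * m + j = (i' * s + a') * m + j)%N -> i = i' /\ a = a'.
  move/addIn/eqP; rewrite eqn_pmul2r // => /eqP E.
  have s0 : (0 < s)%N by exact: leq_ltn_trans (ltn_ord a).
  have E1 : i = i' :> nat.
    have := congr1 (fun x => x %/ s)%N E.
    by rewrite !divnMDl // !divn_small // !addn0.
  by move: E; rewrite E1 => /addnI E; split; apply: val_inj.
have Finj : injective F.
  move=> h h' /ffunP E; apply/ffunP => i; have := E i; rewrite !ffunE.
  by move/(congr1 val) => /= /dec[].
have -> : (s ^ k = #|[set F h | h : {ffun 'I_k -> 'I_s}]%SET|)%N.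
  by rewrite card_imset // card_ffun !card_ord.
apply: subset_leq_card; apply/fintype.subsetP => _ /imsetP[h _ ->]; rewrite inE.
apply/forallP => i; apply/forallP => i'; apply/implyP => ne.
apply: adj_planted_class.
  by rewrite /in_class !ffunE /= !modnMDl !modn_small ?eqxx.
rewrite !ffunE -(inj_eq val_inj) /=; apply: contraNneq ne.
by case/dec => ->.
Qed.

Section QueryLowerBound.
Variables (R : realType) (n k : nat) (eps p : R) (p01 : 0 <= p <= 1).
Variable A : ralg R n bool.
Hypothesis qcA : quality_control (gnp n p01) (rho_clique k p01) eps (pr_output A).

Let pr_bool (G : graph n) : pr_output A G true + pr_output A G false = 1.
Proof. by rewrite -(pr_output_sum1 A G) big_bool. Qed.

(** Every planted graph has at least twice the expected count and must be rejected. So [G] is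
    accepted with probability at most [1/3] plus the hits of class [j]; averaging over [j] gives
    [2/3 <= 1/3 + queries / m]. *)
Lemma quality_control_planted (m s : nat) :
  (0 < m)%N -> (k * s * m <= n)%N -> eps < 1 ->
  2 * (n%:R ^+ k * p ^+ 'C(k, 2)) <= s%:R ^+ k ->
  m%:R <= 3 * (queries A)%:R :> R.
Proof.
move=> m0 ksm eps1 hs; have [acc rej] := qcA.
have m0R : 0 < m%:R :> R by rewrite ltr0n.
have bad (j : 'I_m) (G : graph n) :
    eps < `|rho_clique k p01 (planted m j G) - 1|.
  rewrite /rho_clique gnp_expect_cliques; set E := (X in _ / X).
  have EB : E <= n%:R ^+ k * p ^+ 'C(k, 2).
    case/andP: p01 => p0 _.
    rewrite ler_wpM2r ?exprn_ge0 // -natrX ler_nat.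
    exact: ffact_le_exp.
  have E0 : 0 <= E by case/andP: p01 => p0 _; rewrite mulr_ge0 ?exprn_ge0.
  (* If the expected count is 0, the quotient is 0 by convention, still at distance 1 from 1. *)
  move: E0; rewrite le_eqVlt => /orP[/eqP<-|E0].
    by rewrite invr0 mulr0 sub0r normrN normr1.
  apply: (@lt_le_trans _ _ 1) => //; apply: le_trans (ler_norm _).
  rewrite lerBrDr ler_pdivlMr //.
  apply: (@le_trans _ _ (2 * (n%:R ^+ k * p ^+ 'C(k, 2)))); first by lra.
  by apply: le_trans hs _; rewrite -natrX ler_nat cliques_planted.
have bnd (G : graph n) : m%:R * pr_output A G true <= m%:R / 3 + (queries A)%:R.
  rewrite -[m in m%:R * _]card_ord -sum1_card natr_sum mulr_suml.
  apply: (@le_trans _ _ (\sum_(j < m) (3^-1 + class_hits m j A G))).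
    apply: ler_sum => j _; rewrite mul1r.
    apply: le_trans (pr_output_planted m j A G true) _; rewrite lerD2r.
    by have := rej _ (bad j G); have := pr_bool (planted m j G); lra.
  rewrite big_split /= sumr_const card_ord -[_^-1 *+ m]mulr_natl lerD2l.
  exact: sum_class_hits.
have : \sum_(G : graph n) gnp n p01 G * (m%:R * pr_output A G true) <=
    \sum_(G : graph n) gnp n p01 G * (m%:R / 3 + (queries A)%:R).
  by apply: ler_sum => G _; rewrite ler_wpM2l ?mass_ge0.
rewrite -mulr_suml mass_sum1 mul1r.
under eq_bigr do rewrite mulrCA.
rewrite -mulr_sumr => h.
have : m%:R * (2 / 3) <= m%:R * \sum_(G : graph n) gnp n p01 G * pr_output A G true.
  by rewrite ler_wpM2l // ltW.
by lra.
Qed.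

(** Without queries the answer has the same law on every graph, whereas the empty graph must be
    rejected and an average one accepted. *)
Lemma quality_control_queries_gt0 :
  (2 <= k)%N -> eps < 1 -> (0 < queries A)%N.
Proof.
move=> k2 eps1; rewrite lt0n; apply/negP => /eqP q0.
have [acc rej] := qcA.
have indep : forall (B : ralg R n bool), queries B = 0%N ->
    forall G G' y, pr_output B G y = pr_output B G' y.
  elim=> //= l mu h IH hq G G' y; apply: eq_bigr => i _; congr (_ * _).
  apply: IH; apply/eqP; rewrite -leqn0 -hq; exact: (leq_bigmax i).
have : eps < `|rho_clique k p01 (finset.set0 : graph n) - 1|.
  rewrite /rho_clique (_ : cliques k _ = 0%N).
    by rewrite mul0r sub0r normrN normr1.
  case: k k2 => [|[|k']] // _; apply/eqP; rewrite cards_eq0; apply/eqP/setP => f.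
  rewrite !inE; apply/negbTE/negP => /forallP/(_ ord0)/forallP/(_ ord_max) /=.
  by case/existsP => e; rewrite inE.
move/rej; have := pr_bool (finset.set0 : graph n).
have : \sum_G gnp n p01 G * pr_output A G true = pr_output A (finset.set0) true.
  under eq_bigr => G _ do rewrite (indep A q0 G finset.set0).
  by rewrite -mulr_suml mass_sum1 mul1r.
by lra.
Qed.

End QueryLowerBound.

(** * Analysis of the box norm tester *)

Section TesterAnalysis.
Variables (R : realType) (n' W D k P : nat) (G : graph n'.+1) (m : memory).
Local Notation n := n'.+1.
Let K := (D * (n %/ P + 1) ^ k)%N.
Let N := (100 * (K * K))%N.
Let Th := ((N + 50 * K) * n ^ 4)%N.
Let A := exec R n W (24 * N + 11) [:: box_tester D k] m.
Let mu : R := box4 (fun x y => adjr R G x y - P%:R / n%:R) / n%:R ^+ 4.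

Hypothesis W_big : (100 < W)%N.
Hypothesis Pn : (P <= n)%N.
Hypothesis D_gt0 : (0 < D)%N.
Hypothesis NW : (9 * n ^ 4 * N.+1 < W)%N.
Hypothesis ThW : (Th < W)%N.
Hypothesis rW : (n %/ P + 1 < W)%N.
Hypothesis m0 : m 0%N = n.
Hypothesis m1 : m 1%N = P.
Hypothesis m6 : m 6%N = 0%N.

Let prE (o : option bool) :
  pr_output A G o = loop_value G (fun x => (x == o)%:R) P Th N 0.
Proof. by rewrite pr_outputE expect_box_tester. Qed.

Let K_gt0 : 0 < K%:R :> R.
Proof. by rewrite ltr0n muln_gt0 D_gt0 expn_gt0 addn1. Qed.

Let N_E : N%:R = 100 * K%:R ^+ 2 :> R.
Proof. by rewrite /N !natrM expr2. Qed.

Let Th_le (a : nat) :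
  (a < Th)%N = (a%:R / n%:R ^+ 4 < N%:R + 50 * K%:R :> R).
Proof.
have n0 : 0 < n%:R ^+ 4 :> R by rewrite exprn_gt0 ?ltr0n.
by rewrite ltr_pdivrMr // /Th -(ltr_nat R) natrM natrX natrD [(50 * K)%:R]natrM.
Qed.

Lemma tester_halts : pr_output A G None = 0.
Proof.
rewrite prE; elim: N 0%N => [|i IH] acc //=.
rewrite -[RHS](@avg4_cst R n' 0); apply: eq_avg4 => u v y z; exact: IH.
Qed.

(** Chebyshev around [N] with deviation [50 K] gives [(2 K mu)^2 + 1/25]. The square is weakened to
    a linear term because only the mean of [mu] over random graphs is known; when [2 K mu > 1] the
    claim is trivial. *)
Lemma tester_rejects_le : pr_output A G (Some false) <= 1 / 25 + 2 * K%:R * mu.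
Proof.
have mu0 : 0 <= mu by rewrite divr_ge0 ?exprn_ge0 ?box4_ge0.
case: (leP (2 * K%:R * mu) 1) => h; last first.
  by apply: le_trans (pr_output_le1 _ _ _) _; lra.
have c0 : 0 < (50 * K%:R) ^+ 2 :> R by rewrite exprn_gt0 // mulr_gt0.
rewrite prE; apply: le_trans.
  apply: (@loop_value_chebyshev R n' G _ P Th N 0 N%:R _ Pn c0).
  move=> a; rewrite Th_le; case: ltP => /= h1; rewrite /eq_op /=.
    by rewrite divr_ge0 ?sqr_ge0 // ltW.
  rewrite ler_pdivlMr // mul1r ler_pXn2r ?nnegrE //; move: h1 K_gt0;
    move: (a%:R / _) N%:R K%:R => x y z; lra.
rewrite avg4_box_term -/mu mul0r add0r.
rewrite (_ : N%:R * (1 + mu) - N%:R = N%:R * mu); last by ring.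
rewrite N_E (_ : (_ + _) / _ = (2 * K%:R * mu) ^+ 2 + 1 / 25); last first.
  by field; rewrite gt_eqF.
rewrite addrC lerD2l expr2 ler_piMl // mulr_ge0 // mulr_ge0 // ltW //.
Qed.

(** Here [N mu >= 100 K], so the threshold lies at least [50 K] below the mean. *)
Lemma tester_accepts_le : 1 <= K%:R * mu -> pr_output A G (Some true) <= 1 / 25.
Proof.
move=> hmu.
have c0 : 0 < (50 * K%:R) ^+ 2 :> R by rewrite exprn_gt0 // mulr_gt0.
have hN : 100 * K%:R <= N%:R * mu.
  by rewrite N_E expr2 -!mulrA ler_pM2l // ler_pMr.
rewrite prE.
apply: le_trans.
  apply: (@loop_value_chebyshev R n' G _ P Th N 0 (N%:R * (1 + mu)) _ Pn c0).
  move=> a; rewrite Th_le; case: ltP => /= h1; rewrite /eq_op /=; last first.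
    by rewrite divr_ge0 ?sqr_ge0 // ltW.
  rewrite ler_pdivlMr // mul1r -[leRHS]sqrrN ler_pXn2r ?nnegrE //; move: h1 K_gt0 hN;
    move: (a%:R / _) N%:R K%:R mu => x y z w; lra.
rewrite avg4_box_term -/mu mul0r add0r subrr expr0n add0r N_E.
by rewrite (_ : _ / _ = 1 / 25) //; field; rewrite gt_eqF.
Qed.

End TesterAnalysis.

(** * From a small box norm to a clique count near its mean *)

Section RhoFromBox.
Variables (R : realType) (n k : nat) (eps p q : R) (p01 : 0 <= p <= 1).

(** The choice of [delta] costs a relative error [eps / 4] against [q^M n^(k+1)]. Replacing [q] by
    [p], and the power of [n] by a falling factorial, costs at most [eps / 4] each, paid for by the
    bound on [n p]. *)
Lemma rho_clique_box4 (G : graph n) :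
  0 < eps -> eps < 1 -> 0 < q -> q <= p -> p - q <= n%:R^-1 ->
  4 * k.+1%:R ^+ 2 <= eps * (n%:R * p) ->
  box4 (fun x y => adjr R G x y - q) <=
    (eps / (8 * k.+1%:R ^+ 2) * n%:R * q ^+ k) ^+ 4 ->
  `|rho_clique k.+1 p01 G - 1| <= eps.
Proof.
move=> e0 e1 q0 qp pq hk hS; have /andP[_ p1] := p01.
have p0 : 0 < p by exact: lt_le_trans qp.
have p0' := ltW p0; have q0' := ltW q0; have e0' := ltW e0.
have k1 : 1 <= k.+1%:R :> R by rewrite ler1n.
have np4 : 4 * k.+1%:R ^+ 2 <= n%:R * p.
  apply: le_trans hk _; rewrite ler_piMl //; last exact: ltW.
  by rewrite mulr_ge0 // ltW.
have npn : n%:R * p <= n%:R by rewrite ler_piMr.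
have kk : k.+1%:R <= k.+1%:R ^+ 2 :> R by rewrite expr2 ler_peMr.
have kn : (k.+1 <= n)%N by rewrite -(ler_nat R); lra.
have n0 : (0 < n)%N by exact: leq_trans kn.
have nR : 0 < n%:R :> R by rewrite ltr0n.
have k2 : 0 < k.+1%:R ^+ 2 :> R by rewrite exprn_gt0 // ltr0n.
set M := 'C(k.+1, 2).
have Mk : M%:R <= k.+1%:R ^+ 2 :> R.
  rewrite -natrX ler_nat /M bin2 -divn2; apply: leq_trans (leq_div _ _) _.
  by rewrite -mulnn leq_mul.
have A01 x y : 0 <= adjr R G x y <= 1.
  by rewrite /adjr; case: (adj G x y) => /=; rewrite ?lexx ?ler01.
have Asym x y : adjr R G x y = adjr R G y x by rewrite /adjr adj_sym.
have := clique_count_quasirandom Asym A01 (q := q)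
   (delta := eps / (8 * k.+1%:R ^+ 2)) (k := k).
rewrite card_ord => /(_ n0 q0 (le_trans qp p1)).
have -> : 2 * k.+1%:R ^+ 2 * (eps / (8 * k.+1%:R ^+ 2)) = eps / 4.
  by move: k2; move: (k.+1%:R ^+ 2) => x x0; field; rewrite gt_eqF.
have d0 : 0 <= eps / (8 * k.+1%:R ^+ 2) by rewrite divr_ge0 ?mulr_ge0 // ltW.
have e4 : eps / 4 <= 1 by lra.
move=> /(_ d0 e4 hS); rewrite -(cliquesE R) -/M.
rewrite /rho_clique gnp_expect_cliques -/M.
set C : R := (cliques _ _)%:R; set F : R := (n ^_ k.+1)%:R.
set B := q ^+ M * _ => hC.
set X := n%:R ^+ k.+1 * p ^+ M.
have X0 : 0 < X by rewrite mulr_gt0 ?exprn_gt0.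
have FX : F * p ^+ M <= X.
  rewrite ler_wpM2r ?exprn_ge0 // /F -natrX ler_nat.
  exact: ffact_le_exp.
have XF : X * (1 - eps / 4) <= F * p ^+ M.
  rewrite mulrAC ler_wpM2r ?exprn_ge0 //.
  apply: le_trans (ffact_ge R n0 kn); rewrite ler_wpM2l ?exprn_ge0 //.
  rewrite lerD2l lerN2 ler_pdivrMr //.
  have : eps * (n%:R * p) <= eps * n%:R by rewrite ler_wpM2l // ltW.
  by lra.
have BX : B <= X.
  by rewrite /B mulrC ler_wpM2l ?exprn_ge0 // lerXn2r ?nnegrE // ltW.
have XB : X * (1 - eps / 4) <= B.
  rewrite /B /X [leRHS]mulrC -mulrA ler_wpM2l ?exprn_ge0 //.
  have -> : q ^+ M = p ^+ M * (1 - (p - q) / p) ^+ M.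
    by rewrite -exprMn; congr (_ ^+ _); field; rewrite gt_eqF.
  rewrite ler_wpM2l ?exprn_ge0 //.
  have x01 : 0 <= (p - q) / p <= 1.
    by rewrite divr_ge0 ?subr_ge0 //= ler_pdivrMr // mul1r lerBlDr lerDl ltW.
  apply: le_trans (bernoulli_le M x01); rewrite lerD2l lerN2.
  rewrite mulrA ler_pdivrMr //.
  apply: (@le_trans _ _ (k.+1%:R ^+ 2 * n%:R^-1)).
    by rewrite ler_pM ?subr_ge0.
  by rewrite ler_pdivrMr //; lra.
have FpM : 0 < F * p ^+ M.
  by apply: lt_le_trans XF; rewrite mulr_gt0 // subr_gt0; lra.
rewrite (_ : C / (F * p ^+ M) - 1 = (C - F * p ^+ M) / (F * p ^+ M)); last first.
  field; rewrite !gt_eqF ?exprn_gt0 //.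
  by move: FpM; rewrite pmulr_lgt0 // exprn_gt0.
rewrite normrM normfV (gtr0_norm FpM) ler_pdivrMr //.
move: hC; rewrite !ler_norml => /andP[hC1 hC2].
move: (F * p ^+ M) FX XF FpM => Y YX XY Y0.
have hB : eps / 4 * B <= eps / 4 * X by rewrite ler_wpM2l // divr_ge0 // ltW.
have hY : eps * (X * (1 - eps / 4)) <= eps * Y by rewrite ler_wpM2l // ltW.
have heX : 0 <= eps * X by rewrite mulr_ge0 // ltW.
have heX2 : eps * (eps * X) <= eps * X by rewrite ler_piMl // ltW.
by apply/andP; split; nra.
Qed.

End RhoFromBox.

Definition tester_time (D m n P : nat) : nat :=
  let K := (D * (n %/ P + 1) ^ m)%N in (24 * (100 * (K * K)) + 11)%N.

Lemma word_modulus_gt (d n : nat) : (0 < d)%N -> (n ^ d < word_modulus d n)%N.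
Proof.
by move=> d0; rewrite /word_modulus mulnC expnM ltn_exp2r // trunc_log_ltn.
Qed.

(** As [n p >= 100], rounding down at most halves [p]. Then [q r] lies between 1 and 2, hence
    [p r <= 4], which bounds [K] from above in terms of [p]. *)
Lemma tester_parameters (R : realType) (D k n : nat) (p : R) :
  (0 < D)%N -> 0 < p <= 1 ->
  (100 * D * 4 ^ (4 * k))%:R <= n%:R * p ^+ (4 * k + 3) ->
  let P := Num.truncn (p * n%:R) in
  let q := P%:R / n%:R in
  let r := (n %/ P + 1)%N in
  let K := (D * r ^ (4 * k))%N in
  [/\ (0 < P <= n)%N, 0 < q <= p, p - q <= n%:R^-1,
      1 <= q * r%:R & K%:R * p ^+ (4 * k) <= (D * 4 ^ (4 * k))%:R /\
      (0 < K)%N && (100 * K <= n)%N].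
Proof.
move=> D0 /andP[p0 p1] hK0 P q r K.
have big0 : (100 <= 100 * D * 4 ^ (4 * k))%N.
  by rewrite -mulnA leq_pmulr // muln_gt0 D0 expn_gt0.
have pm0 j : 0 < p ^+ j by rewrite exprn_gt0.
have pm1 j : p ^+ j <= 1 by rewrite exprn_ile1 // ltW.
have hnp : 100 <= n%:R * p.
  have : (100%N)%:R <= n%:R * p ^+ (4 * k + 3).
    by apply: le_trans hK0; rewrite ler_nat.
  move=> h; apply: le_trans h _; rewrite ler_wpM2l // addnS exprS.
  by rewrite ler_piMr // ltW.
have n0 : 0 < n%:R :> R.
  by rewrite ltr0n lt0n; apply/eqP => E; move: hnp; rewrite E mul0r; lra.
have pn0 : 0 <= p * n%:R by rewrite mulr_ge0 // ltW.
have /andP[P1 P2] := truncn_itv pn0; rewrite -/P in P1 P2.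
rewrite -natr1 in P2.
have PR : 0 < P%:R :> R by lra.
have Pn : P%:R <= n%:R :> R by apply: le_trans P1 _; rewrite ler_piMl.
have P0 : (0 < P)%N by rewrite -(ltr_nat R).
have qn : q * n%:R = P%:R by rewrite /q; field; rewrite gt_eqF.
have q0 : 0 < q by rewrite divr_gt0.
have qp : q <= p by rewrite ler_pdivrMr.
have hq : p <= 2 * q.
  by rewrite -(ler_pM2r n0) -mulrA qn; lra.
have qr1 : 1 <= q * r%:R.
  rewrite -(ler_pM2r n0) mulrAC qn mul1r -natrM ler_nat /r addn1 mulnC ltnW //.
  exact: ltn_ceil.
have qr2 : q * r%:R <= 2.
  rewrite -(ler_pM2r n0) mulrAC qn -!natrM ler_nat /r mulnDr muln1 mulnC.
  by rewrite mulSn mul1n leq_add ?leq_trunc_div // -(ler_nat R).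
have pr : p * r%:R <= 4.
  have : p * r%:R <= 2 * q * r%:R by rewrite ler_wpM2r.
  by lra.
have hK : K%:R * p ^+ (4 * k) <= (D * 4 ^ (4 * k))%:R.
  rewrite /K !natrM !natrX -mulrA -exprMn ler_wpM2l // lerXn2r ?nnegrE //.
    by rewrite mulr_ge0 // ltW.
  by rewrite mulrC.
split=> //; last split=> //.
- by rewrite P0 -(ler_nat R).
- by rewrite q0.
- rewrite -(ler_pM2r n0) mulrBl qn mulVf ?gt_eqF //; lra.
- rewrite muln_gt0 D0 expn_gt0 {1}/r addn1 /= -(ler_nat R).
  rewrite -(ler_pM2r (pm0 (4 * k)%N)).
  apply: (@le_trans _ _ (n%:R * p ^+ (4 * k + 3))).
    apply: le_trans hK0; rewrite -mulnA natrM -mulrA [leRHS]natrM.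
    by apply: ler_wpM2l; [exact: ler0n|exact: hK].
  by rewrite exprD mulrA ler_piMr // mulr_ge0 // ltW.
Qed.

Lemma tester_probabilities (R : realType) (n W D m P : nat) (mem : memory)
    (G : graph n) :
  let K := (D * (n %/ P + 1) ^ m)%N in
  let N := (100 * (K * K))%N in
  let A := exec R n W (24 * N + 11) [:: box_tester D m] mem in
  let mu := box4 (fun x y => adjr R G x y - P%:R / n%:R) / n%:R ^+ 4 in
  (0 < n)%N -> (100 < W)%N -> (P <= n)%N -> (0 < D)%N ->
  (9 * n ^ 4 * N.+1 < W)%N -> ((N + 50 * K) * n ^ 4 < W)%N ->
  (n %/ P + 1 < W)%N -> mem 0%N = n -> mem 1%N = P -> mem 6%N = 0%N ->
  [/\ pr_output A G None = 0,
      pr_output A G (Some false) <= 1 / 25 + 2 * K%:R * mu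
    & 1 <= K%:R * mu -> pr_output A G (Some true) <= 1 / 25].
Proof.
case: n G => // n G K N A mu _ *; split.
- exact: tester_halts.
- exact: tester_rejects_le.
- exact: tester_accepts_le.
Qed.

(** Since [100 K <= n], the counters and sums are at most about [n^6], so words of [8 (log2 n + 1)]
    bits suffice. *)
Lemma tester_word_bounds (n K W : nat) :
  (0 < K)%N -> (100 * K <= n)%N -> (n ^ 8 < W)%N ->
  [/\ (100 < W)%N, (9 * n ^ 4 * (100 * (K * K)).+1 < W)%N,
      ((100 * (K * K) + 50 * K) * n ^ 4 < W)%N & (n + 1 < W)%N].
Proof.
move=> K0 Kn nW.
have n100 : (100 <= n)%N by lia.
have n68 : (n ^ 4 * (n * n) <= n ^ 8)%N.
  by rewrite mulnn -expnD leq_pexp2l //; lia.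
have X1 : (0 < n ^ 4)%N by rewrite expn_gt0; lia.
move: (n ^ 4)%N (n ^ 8)%N X1 n68 nW => X Y X1 n68 nW.
have KK : (1600 * (K * K) <= n * n)%N.
  have h40 : (40 * K <= n)%N by lia.
  by have := leq_mul h40 h40; lia.
have K1 : (K <= K * K)%N by rewrite leq_pmulr.
have KKn : (9 * (100 * (K * K)).+1 <= n * n)%N by lia.
have KKn' : (100 * (K * K) + 50 * K <= n * n)%N by lia.
have nn : (100 * n <= n * n)%N by rewrite leq_mul2r n100 orbT.
have hX := leq_mul (leqnn X) KKn; have hX' := leq_mul (leqnn X) KKn'.
have hXn : (1 * (n * n) <= X * (n * n))%N by rewrite leq_mul2r X1 orbT.
by split; lia.
Qed.

Theorem box_tester_quality_control (R : realType) (k : nat) (eps : R) :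
  0 < eps -> eps < 1 ->
  exists (D : nat) (K0 C : R), 0 < K0 /\ 0 < C /\
  forall (n : nat) (p : R) (p01 : 0 <= p <= 1), 0 < p ->
    K0 <= n%:R * p ^+ (4 * k + 3) ->
    let T := tester_time D (4 * k) n (Num.truncn (p * (n ^ 1)%:R)) in
    let A := run (box_tester D (4 * k)) 8 1 n p T in
    [/\ halts A,
        quality_control (gnp n p01) (rho_clique k.+1 p01) eps
          (fun G b => pr_output A G (Some b))
      & T%:R * p ^+ (8 * k) <= C].
Proof.
move=> e0 e1.
pose invd : R := 8 * k.+1%:R ^+ 2 / eps.
have k20 : 0 < k.+1%:R ^+ 2 :> R by rewrite exprn_gt0 // ltr0n.
have invd0 : 0 < invd by rewrite divr_gt0 // mulr_gt0.
(* [D] dominates the fourth power of the inverse of [delta = eps / (8 (k+1)^2)]; with [q r >= 1]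
   this makes [K (delta q^k)^4 >= 1]. *)
pose D := (Num.truncn (invd ^+ 4)).+1.
have hD : invd ^+ 4 <= D%:R by rewrite ltW // truncnS_gt.
(* [c] is the bound required by [tester_parameters], and [c'] the one on [n p] required by
   [rho_clique_box4]. *)
pose c := (100 * D * 4 ^ (4 * k))%N.
pose c' := 4 * k.+1%:R ^+ 2 / eps.
have c'0 : 0 < c' by rewrite divr_gt0 // mulr_gt0.
have [C0 C0_gt0 hC0] : exists2 C0 : nat, (0 < C0)%N &
    forall x, (0 < x)%N -> (24 * (100 * x) + 11 <= C0 * x)%N.
  by exists 2411%N => // x; lia.
exists D, (c%:R + c'), (C0%:R * (D * 4 ^ (4 * k))%:R ^+ 2).
split; first by rewrite ltr_wpDl.
split; first by rewrite mulr_gt0 ?exprn_gt0 ?ltr0n // muln_gt0 expn_gt0.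
move=> n p p01 p0 hK0; rewrite expn1; set P := Num.truncn _; move=> T A.
have /andP[_ p1] := p01.
have p01' : 0 < p <= 1 by rewrite p0.
have hc : c%:R <= n%:R * p ^+ (4 * k + 3) by lra.
have hc' : c' <= n%:R * p ^+ (4 * k + 3) by have : 0 <= c%:R :> R by []; lra.
have [/andP[P0 Pn] /andP[q0 qp] pq qr [hK /andP[Kpos Kn]]] :=
  tester_parameters (ltn0Sn _) p01' hc.
rewrite -/P in P0 Pn q0 qp pq qr hK Kpos Kn.
set q := P%:R / n%:R in q0 qp pq qr.
set r := (n %/ P + 1)%N in qr hK Kpos Kn.
set K := (D * r ^ (4 * k))%N in hK Kpos Kn.
have TE : T = (24 * (100 * (K * K)) + 11)%N by [].
pose W := word_modulus 8 n.
have nW : (n ^ 8 < W)%N by exact: word_modulus_gt.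
have [W100 NW ThW nn] := tester_word_bounds Kpos Kn nW.
have rW : (r < W)%N by apply: leq_ltn_trans nn; rewrite leq_add2r leq_div.
have nltW : (n < W)%N by apply: leq_ltn_trans nn; rewrite leq_addr.
have PW : (P < W)%N by exact: leq_ltn_trans nltW.
have n0 : (0 < n)%N by exact: leq_trans P0 Pn.
have nR : 0 < n%:R :> R by rewrite ltr0n.
pose mem := input 8 1 n p.
have mem0 : mem 0%N = n by rewrite /mem /input /write /= modn_small.
have mem1 : mem 1%N = P.
  by rewrite /mem /input /write /= expn1 modn_small.
have mem6 : mem 6%N = 0%N by [].
pose mu (G : graph n) : R := box4 (fun x y => adjr R G x y - q) / n%:R ^+ 4.
have K0R : 0 < K%:R :> R by rewrite ltr0n.
have prA G :=
  tester_probabilities R G n0 W100 Pn (ltn0Sn _) NW ThW rW mem0 mem1 mem6.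
have hnone G : pr_output A G None = 0 by case: (prA G).
have hrej G : pr_output A G (Some false) <= 1 / 25 + 2 * K%:R * mu G.
  by case: (prA G).
have hacc G : 1 <= K%:R * mu G -> pr_output A G (Some true) <= 1 / 25.
  by case: (prA G).
have sum1 G : pr_output A G (Some true) + pr_output A G (Some false) = 1.
  rewrite -(pr_output_sum1 A G) (bigD1 None) //= hnone add0r.
  rewrite (bigD1 (Some true)) //= (bigD1 (Some false)) //= big1 ?addr0 //.
  by case=> [[]|].
split=> //.
- split.
    have pq4 : (p - q) ^+ 4 <= n%:R^-1 ^+ 4.
      by rewrite lerXn2r // nnegrE ?subr_ge0 // invr_ge0.
    have q01 : 0 <= q <= 1 by rewrite ltW //= (le_trans qp).
    have := gnp_expect_box4 n p01 q01; set S := \sum_G _ => hS.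
    have hS7 : S <= 7 * n%:R ^+ 3.
      apply: le_trans hS _.
      have : n%:R ^+ 4 * (p - q) ^+ 4 <= 1.
        rewrite -[leRHS](@mulfV _ (n%:R ^+ 4)) ?expf_neq0 ?gt_eqF // -exprVn.
        by rewrite ler_wpM2l ?exprn_ge0.
      have : 1 <= n%:R ^+ 3 :> R by rewrite exprn_ege1 // ler1n.
      by lra.
    (* Integrating this pointwise bound gives acceptance at least [24/25 - 14 K / n], and
       [100 K <= n]. *)
    have lbG : \sum_G gnp n p01 G * (24 / 25 - 2 * K%:R * mu G) <=
        \sum_G gnp n p01 G * pr_output A G (Some true).
      apply: ler_sum => G _; rewrite ler_wpM2l ?mass_ge0 //.
      by have := hrej G; have := sum1 G; lra.
    apply: le_trans lbG.
    under eq_bigr do rewrite mulrBr.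
    rewrite sumrB -mulr_suml mass_sum1 mul1r.
    have -> : \sum_G gnp n p01 G * (2 * K%:R * mu G) = 2 * K%:R / n%:R ^+ 4 * S.
      rewrite mulr_sumr; apply: eq_bigr => G _; rewrite /mu.
      by rewrite -[gnp n p01 G]/(gnp_mass p G); ring.
    have : 2 * K%:R / n%:R ^+ 4 * S <= 14 / 100.
      apply: (@le_trans _ _ (2 * K%:R / n%:R ^+ 4 * (7 * n%:R ^+ 3))).
        by rewrite ler_wpM2l // divr_ge0 ?exprn_ge0 // mulr_ge0 // ltW.
      rewrite (_ : _ * _ = 14 * (K%:R / n%:R)); last by field; rewrite gt_eqF.
      rewrite ler_wpM2l // ler_pdivrMr //.
      have : (100 * K)%:R <= n%:R :> R by rewrite ler_nat.
      by rewrite natrM; lra.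
    by lra.
  move=> G bad.
  suff : 1 <= K%:R * mu G by move/hacc; have := sum1 G; lra.
  (* The contrapositive of the counting result: a bad ratio forces a large box norm. *)
  have : ~~ (box4 (fun x y => adjr R G x y - q) <=
      (eps / (8 * k.+1%:R ^+ 2) * n%:R * q ^+ k) ^+ 4).
    apply: contraTN bad => h; rewrite -leNgt.
    apply: rho_clique_box4 h => //.
    have : c' <= n%:R * p.
      apply: le_trans hc' _; rewrite ler_wpM2l // addnS exprS.
      by rewrite ler_piMr ?(ltW p0) // exprn_ile1 // ltW.
    by rewrite /c' ler_pdivrMr // [leRHS]mulrC.
  rewrite -ltNge => /ltW h.
  apply: (@le_trans _ _ (K%:R * (invd^-1 * q ^+ k) ^+ 4)); last first.
    rewrite ler_wpM2l ?(ltW K0R) // /mu ler_pdivlMr ?exprn_gt0 // -exprMn.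
    apply: le_trans h; rewrite le_eqVlt; apply/orP; left; apply/eqP.
    by congr (_ ^+ 4); rewrite /invd invf_div mulrAC.
  rewrite exprMn -exprM mulnC mulrCA exprVn.
  rewrite ler_pdivlMl ?exprn_gt0 // mulr1 /K natrM natrX -mulrA -exprMn.
  rewrite [_%:R * q]mulrC; apply: le_trans hD _.
  by rewrite ler_peMr // exprn_ege1.
- have KP : (K%:R * p ^+ (4 * k)) ^+ 2 <= (D * 4 ^ (4 * k))%:R ^+ 2.
    by rewrite lerXn2r ?nnegrE // mulr_ge0 ?exprn_ge0 // ltW.
  apply: (@le_trans _ _ (C0%:R * (K%:R * p ^+ (4 * k)) ^+ 2)); last first.
    by rewrite ler_wpM2l.
  rewrite exprMn -exprM mulnAC mulrA ler_wpM2r ?exprn_ge0 ?(ltW p0) //.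
  have : (T <= C0 * (K * K))%N by rewrite TE hC0 // muln_gt0 Kpos.
  by rewrite -(ler_nat R) !natrM expr2.
Qed.

(** * Quality control of clique counts *)

(** Here [y] stands for [p^((k-1)/2)]. With [m] about [c / y] classes, the blocks have size [s]
    about [n y / (k c)]: [4 k c <= 1] makes [s >= 2 n y], and [k c <= n y] makes the blocks
    nonempty. *)
Lemma query_lower_bound (R : realType) (n k : nat) (eps p y c : R)
    (p01 : 0 <= p <= 1) (A : ralg R n bool) :
  quality_control (gnp n p01) (rho_clique k p01) eps (pr_output A) ->
  (2 <= k)%N -> eps < 1 -> 0 < y -> y ^+ k = p ^+ 'C(k, 2) ->
  0 < c -> 4 * k%:R * c <= 1 -> k%:R * c <= n%:R * y ->
  c / 12 < (queries A)%:R * y.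
Proof.
move=> qcA k2 eps1 y0 yk c0 kc knc; rewrite ltNge; apply/negP => hq.
have k0 : 0 < k%:R :> R by rewrite ltr0n ltnW.
have q1 : 1 <= (queries A)%:R :> R.
  by rewrite ler1n; exact: quality_control_queries_gt0 qcA k2 eps1.
(* With at least one query, [y <= c / 12]; then rounding leaves [m y >= 11 c / 12], against the
   [m y <= c / 4] forced by few queries. *)
have yc : y <= c / 12 by apply: le_trans hq; rewrite ler_peMl // ltW.
have x0 : 0 <= c / y by rewrite divr_ge0 // ltW.
have /andP[m1 m2] := truncn_itv x0; set m := Num.truncn _ in m1 m2.
rewrite -natr1 in m2.
move: m1; rewrite ler_pdivlMr // => m1.
move: m2; rewrite ltr_pdivrMr // mulrDl mul1r => m2.
have m0 : (0 < m)%N by rewrite -(ltr_nat R) -(ltr_pM2r y0); lra.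
have mR : 0 < m%:R :> R by rewrite ltr0n.
pose s := (n %/ (k * m))%N.
have ksm : (k * s * m <= n)%N by rewrite mulnAC mulnC leq_trunc_div.
have km0 : (0 < k * m)%N by rewrite muln_gt0 m0 ltnW.
have kmn : k%:R * m%:R <= n%:R :> R.
  rewrite -(ler_pM2r y0) -mulrA; apply: le_trans knc.
  by rewrite ler_pM2l.
have s2 : n%:R <= 2 * s%:R * (k%:R * m%:R) :> R.
  rewrite -!natrM ler_nat.
  have h1 := ltn_ceil n km0; rewrite -/s in h1.
  have s1 : (1 <= s)%N by rewrite divn_gt0 // -(ler_nat R) natrM.
  apply: leq_trans (ltnW h1) _; rewrite leq_mul2r; apply/orP; right.
  by rewrite mul2n -addnn -addn1 leq_add2l.
have hs : 2 * (n%:R * y) <= s%:R.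
  have h : 2 * (n%:R * y) <= 4 * s%:R * k%:R * (m%:R * y).
    rewrite (_ : _ * (m%:R * y) = 2 * (2 * s%:R * (k%:R * m%:R) * y)); last by ring.
    by rewrite ler_pM2l // ler_pM2r.
  apply: le_trans h _.
  apply: (@le_trans _ _ (4 * s%:R * k%:R * c)).
    by rewrite ler_wpM2l // mulr_ge0 // mulr_ge0.
  by rewrite (_ : _ * c = s%:R * (4 * k%:R * c)) ?ler_piMr //; ring.
have hsk : 2 * (n%:R ^+ k * p ^+ 'C(k, 2)) <= s%:R ^+ k.
  rewrite -yk -exprMn; apply: (@le_trans _ _ ((2 * (n%:R * y)) ^+ k)).
    have z0 : 0 <= n%:R * y by rewrite mulr_ge0 // ltW.
    rewrite [leRHS]exprMn ler_wpM2r ?exprn_ge0 //.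
    by rewrite ler_eXnr ?ler1n // ltnW.
  by rewrite lerXn2r ?nnegrE // mulr_ge0 // mulr_ge0 // ltW.
have := quality_control_planted qcA m0 ksm eps1 hsk.
move=> h; have : m%:R * y <= 3 * (queries A)%:R * y by rewrite ler_pM2r.
by lra.
Qed.

Fixpoint read_all (R : realType) (n : nat) (dec : graph n -> bool)
  (l : seq (vpair n)) (H : graph n) : ralg R n bool :=
  if l is e :: l' then
    Query (val e).1 (val e).2
      (fun b => read_all R dec l' (if b then (e |: H)%SET else H))
  else Output (dec H).

Lemma pr_output_read_all (R : realType) (n : nat) (dec : graph n -> bool)
    (l : seq (vpair n)) (H G : graph n) (b : bool) :
  pr_output (read_all R dec l H) G b =
  (dec (H :|: [set e in l | e \in G])%SET == b)%:R.
Proof.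
elim: l H => [|e l IH] H /=.
  by congr ((dec _ == b)%:R); apply/setP => e; rewrite !inE orbF.
rewrite adj_vpair IH; congr ((dec _ == b)%:R); apply/setP => e'.
case: (boolP (e \in G)) => eG; rewrite !inE; have [->|] := eqVneq e' e => //=.
- by rewrite eG orbT.
- by rewrite (negbTE eG) !andbF.
Qed.

Lemma queries_read_all (R : realType) (n : nat) (dec : graph n -> bool)
    (l : seq (vpair n)) (H : graph n) :
  queries (read_all R dec l H) = size l.
Proof. by elim: l H => //= e l IH H; rewrite !IH maxnn. Qed.

(** Once the whole graph is known, the test on [rho] is exact, and concentration is precisely its
    acceptance probability. *)
Lemma read_all_quality_control (R : realType) (n : nat) (D : fdist R (graph n))
    (rho : graph n -> R) (eps : R) :
  concentrated D rho eps ->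
  quality_control D rho eps (pr_output
    (read_all R (fun G => `|rho G - 1| <= eps) (enum {: vpair n}) finset.set0)).
Proof.
move=> hc.
have E (G : graph n) :
    (finset.set0 :|: [set e in enum {: vpair n} | e \in G])%SET = G.
  by apply/setP => e; rewrite !inE mem_enum.
split=> [|G bad]; last first.
  by rewrite pr_output_read_all E (lt_geF bad) eqxx mulr1n; lra.
apply: (@le_trans _ _ (9 / 10)); first by lra.
apply: le_trans hc _; rewrite big_mkcond /=; apply: ler_sum => G _.
rewrite pr_output_read_all E; case: ifP => _ /=; first by rewrite mulr1.
by rewrite mulr0.
Qed.

Lemma expect_le (R : realType) (n : nat) (X : Type) (A : ralg R n X)
    (G : graph n) (f g : X -> R) :
  (forall x, f x <= g x) -> expect A G f <= expect A G g.
Proof.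
move=> fg; elim: A => //= m mu h IH.
by apply: ler_sum => i _; rewrite ler_wpM2l ?mass_ge0.
Qed.

Lemma quality_control_le (R : realType) (X : finType) (D : fdist R X)
    (rho : X -> R) (eps : R) (out out' : X -> bool -> R) :
  (forall x b, out x b <= out' x b) ->
  quality_control D rho eps out -> quality_control D rho eps out'.
Proof.
move=> le [acc rej]; split=> [|x bad]; last exact: le_trans (rej x bad) (le _ _).
apply: le_trans acc _; apply: ler_sum => x _.
by rewrite ler_wpM2l ?mass_ge0.
Qed.

Lemma card_vpair_le (n : nat) : (#|{: vpair n}| <= n * n)%N.
Proof.
by rewrite card_sig (leq_trans (max_card _)) // card_prod !card_ord.
Qed.

Lemma le_powR_neg (R : realType) (x C p : R) (m k : nat) :
  0 < p -> p <= 1 -> 0 <= x -> (m <= 8 * k)%N -> x * p ^+ m <= C ->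
  `|x| <= C * `|p `^ (- (8 * k%:R))|.
Proof.
move=> p0 p1 x0 mk h.
have -> : p `^ (- (8 * k%:R)) = (p ^+ (8 * k))^-1.
  by rewrite powRN -natrM powR_mulrn // ltW.
have pk : 0 < p ^+ (8 * k) by rewrite exprn_gt0.
rewrite !ger0_norm // ?invr_ge0 ?(ltW pk) // ler_pdivlMr //.
apply: le_trans h; rewrite ler_wpM2l //.
by apply: ler_wiXn2l => //; exact: ltW.
Qed.

Theorem theorem3p1 (R : realType) :
  exists c1 c2 c3 : R, [/\ 0 < c1, 0 < c2, 0 < c3 &
  forall (k : nat) (eps : R) (p : nat -> R) (p01 : forall n, 0 <= p n <= 1),
    (2 <= k)%N -> 0 < eps -> eps < 1 ->
    (\forall n \near \oo, clique_concentrated k eps p01 n) ->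
    p =Omega_\oo (fun n : nat => n%:R `^ (- (2 / k.-1%:R))) ->
    [/\ exists A : forall n, ralg R n bool,
          (fun n : nat => (queries (A n))%:R : R) =O_\oo
            (fun n : nat => p n `^ (- (c1 * k%:R))) /\
          solves k eps p01 A,
        p =Omega_\oo (fun n : nat =>
            (ln n%:R / n%:R) `^ (1 / (4 * k - 1)%N%:R)) ->
          exists (c : cmd) (d e : nat) (T : nat -> nat),
            (fun n : nat => (T n)%:R : R) =O_\oo
              (fun n : nat => p n `^ (- (c3 * k%:R))) /\
            solves_in_time k eps p01 c d e T
      & forall A : forall n, ralg R n bool,
          (fun n : nat => (queries (A n))%:R : R) =o_\oo
            (fun n : nat => p n `^ (- (c2 * k%:R))) ->
          ~ solves k eps p01 A]].
Proof.
(* Below, [k] is the clique size minus one. The tester costs [p^(-8k)] and reading the graph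
   [p^(-(8k+6))], both within [p^(-8(k+1))]. For (3), [(k+1)/4 <= k/2] as soon as [k >= 1]. *)
exists 8, (1 / 4), 8; split; [by []|by []|by []|].
case=> // k eps p p01 k2 e0 e1 hconc.
rewrite eqOmegaE eqOmegaO => /eqO_exP[c c0 hp].
have p1 n : p n <= 1 by case/andP: (p01 n).
have p0' n : 0 <= p n by case/andP: (p01 n).
have pgt0 : \forall n \near \oo, 0 < p n.
  near=> n.
  have n0 : (0 < n)%N by near: n; exact: nbhs_infty_gt.
  have : `|n%:R `^ (- (2 / k%:R))| <= c * `|p n| by near: n; exact: hp.
  rewrite gtr0_norm ?powR_gt0 ?ltr0n // => h.
  rewrite lt_neqAle p0' andbT; apply/eqP => E; move: h.
  by rewrite -E normr0 mulr0 leNgt powR_gt0 ?ltr0n.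
have [D [K0 [C [K00 [C0 tester]]]]] := box_tester_quality_control k e0 e1.
pose T n := tester_time D (4 * k) n (Num.truncn (p n * (n ^ 1)%:R)).
pose B n := run (box_tester D (4 * k)) 8 1 n (p n) (T n).
split.
(* The choice is made separately for each [n]. [None] is turned into Reject, harmlessly since the
   outputs [Some b] keep their probability. *)
- exists (fun n => if K0 <= n%:R * p n ^+ (4 * k + 3)
    then ralg_map (fun o => o == Some true) (B n)
    else read_all R (fun G => `|rho_clique k.+1 (p01 n) G - 1| <= eps)
           (enum {: vpair n}) finset.set0).
  split.
    apply/eqO_exP; exists (C + K0 ^+ 2); first by rewrite addr_gt0 // exprn_gt0.
    near=> n.
    have pn0 : 0 < p n by near: n; exact: pgt0.
    case: (leP K0 (n%:R * p n ^+ (4 * k + 3))) => h.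
      have [_ _ hT] := tester n (p n) (p01 n) pn0 h.
      apply: (@le_powR_neg _ _ _ _ (8 * k)) => //; first by rewrite leq_mul2l leqnSn.
      rewrite queries_map (@le_trans _ _ ((T n)%:R * p n ^+ (8 * k))) //.
        by rewrite ler_wpM2r ?exprn_ge0 // ler_nat queries_exec.
      by apply: le_trans hT _; rewrite lerDl exprn_ge0 // ltW.
    (* In this case [n < K0 p^(-(4k+3))], and there are at most [n^2] pairs. *)
    apply: (@le_powR_neg _ _ _ _ ((4 * k + 3) * 2)) => //; first by lia.
    rewrite queries_read_all -cardE.
    apply: (@le_trans _ _ ((n%:R * p n ^+ (4 * k + 3)) ^+ 2)).
      rewrite exprMn -exprM ler_wpM2r ?exprn_ge0 //.
      by rewrite -natrX ler_nat -mulnn card_vpair_le.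
    apply: (@le_trans _ _ (K0 ^+ 2)); last by rewrite lerDr ltW.
    by rewrite lerXn2r ?nnegrE ?mulr_ge0 ?exprn_ge0 // ltW.
  near=> n.
  have pn0 : 0 < p n by near: n; exact: pgt0.
  case: (leP K0 (n%:R * p n ^+ (4 * k + 3))) => h.
    have [_ qc _] := tester n (p n) (p01 n) pn0 h.
    apply: quality_control_le qc => G b.
    rewrite !pr_outputE expect_map; apply: expect_le => o /=.
    by case: eqP => // ->; case: b.
  apply: read_all_quality_control.
  by near: n; exact: hconc.
- rewrite eqOmegaE eqOmegaO => /eqO_exP[c' c'0 hln].
  exists (box_tester D (4 * k)), 8%N, 1%N, T.
  have hK0 : \forall n \near \oo, K0 <= n%:R * p n ^+ (4 * k + 3).
    near=> n.
    have n1 : (1 <= n)%N by near: n; exact: nbhs_infty_ge.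
    have nR : 0 < n%:R :> R by rewrite ltr0n.
    have M3 : (4 * k.+1 - 1 = 4 * k + 3)%N by lia.
    (* The logarithm eventually exceeds any constant, including [K0] times the power of the unknown
       constant [c'] behind the Omega. *)
    have lnn : K0 * c' ^+ (4 * k + 3) <= ln n%:R.
      rewrite -ler_expR lnK ?posrE //.
      by near: n; exact: nbhs_infty_ger.
    have ln0 : 0 <= ln n%:R / n%:R :> R.
      by rewrite divr_ge0 // ln_ge0 // ler1n.
    have : `|(ln n%:R / n%:R) `^ (1 / (4 * k.+1 - 1)%N%:R)| <= c' * `|p n|.
      by near: n; exact: hln.
    rewrite M3 ger0_norm ?powR_ge0 // ger0_norm // => h.
    have : ((ln n%:R / n%:R) `^ (1 / (4 * k + 3)%N%:R)) ^+ (4 * k + 3) <=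
        (c' * p n) ^+ (4 * k + 3).
      by rewrite lerXn2r // nnegrE ?powR_ge0 // mulr_ge0 // ltW.
    have M0 : (4 * k + 3)%:R != 0 :> R by rewrite pnatr_eq0 addnS.
    rewrite -powR_mulrn ?powR_ge0 // -powRrM mul1r mulVf // powRr1 //.
    rewrite ler_pdivrMr // exprMn => h2.
    have cM : 0 < c' ^+ (4 * k + 3) by rewrite exprn_gt0.
    rewrite -(ler_pM2r cM); apply: le_trans lnn _; apply: le_trans h2 _.
    by rewrite le_eqVlt; apply/orP; left; apply/eqP; ring.
  split.
    apply/eqO_exP; exists C => //; near=> n.
    have pn0 : 0 < p n by near: n; exact: pgt0.
    have h : K0 <= n%:R * p n ^+ (4 * k + 3) by near: n; exact: hK0.
    have [_ _ hT] := tester n (p n) (p01 n) pn0 h.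
    by apply: (@le_powR_neg _ _ _ _ (8 * k)) => //; rewrite leq_mul2l leqnSn.
  near=> n.
  have pn0 : 0 < p n by near: n; exact: pgt0.
  have h : K0 <= n%:R * p n ^+ (4 * k + 3) by near: n; exact: hK0.
  by have [hh qc _] := tester n (p n) (p01 n) pn0 h.
- move=> A /eqoP ho hA.
  have k0 : 0 < k%:R :> R by rewrite ltr0n -ltnS.
  pose x : R := k%:R / 2.
  (* The two terms of the minimum give the two conditions on [c] in [query_lower_bound]. *)
  pose a : R := Num.min (4 * k.+1%:R)^-1 (k.+1%:R * c `^ x)^-1.
  have cx : 0 < c `^ x by rewrite powR_gt0.
  have kS : 0 < k.+1%:R :> R by rewrite ltr0n.
  have a0 : 0 < a by rewrite lt_min !invr_gt0 !mulr_gt0.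
  have a12 : 0 < a / 12 by rewrite divr_gt0.
  near \oo => n.
  have n0 : 0 < n%:R :> R by rewrite ltr0n; near: n; exact: nbhs_infty_gt.
  have pn0 : 0 < p n by near: n; exact: pgt0.
  have qcA : clique_qc k.+1 eps p01 (pr_output (A n)) by near: n; exact: hA.
  have hq : `|(queries (A n))%:R : R| <=
      a / 12 * `|p n `^ (- (1 / 4 * k.+1%:R))| by near: n; exact: ho.
  have hpn : `|n%:R `^ (- (2 / k%:R))| <= c * `|p n| by near: n; exact: hp.
  pose y := p n `^ x.
  have y0 : 0 < y by rewrite powR_gt0.
  have yk : y ^+ k.+1 = p n ^+ 'C(k.+1, 2).
    rewrite -powR_mulrn ?powR_ge0 // -powRrM -powR_mulrn //; congr (_ `^ _).
    have := mul_bin_diag k.+1 1; rewrite bin1 /= => /(congr1 (fun i => i%:R : R)).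
    by rewrite !natrM /x => h; lra.
  have := query_lower_bound qcA k2 e1 y0 yk a0.
  have h1 : 4 * k.+1%:R * a <= 1.
    by rewrite mulrC -ler_pdivlMr ?mulr_gt0 // mul1r ge_min lexx.
  have h2 : k.+1%:R * a <= n%:R * y.
    (* Raising [n^(-2/k) <= c p] to the power [k / 2] gives [n^(-1) <= c^x y]: the lower bound on
       [p] is what lets the classes fit. *)
    have ny : (c `^ x)^-1 <= n%:R * y.
      move: hpn; rewrite !ger0_norm ?powR_ge0 // => hpn.
      have : (n%:R `^ (- (2 / k%:R))) `^ x <= (c * p n) `^ x.
        rewrite ge0_ler_powR ?nnegrE ?powR_ge0 // ?divr_ge0 //.
        by rewrite mulr_ge0 // ltW.
      rewrite -powRrM powRM // ?(ltW c0) //.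
      rewrite (_ : - (2 / k%:R) * x = - 1); last first.
        by rewrite /x; field; rewrite gt_eqF.
      rewrite powR_inv1 // -/y.
      rewrite -(ler_pM2l n0) mulfV ?gt_eqF // => h.
      by rewrite -[leLHS]mul1r ler_pdivrMr // -mulrA [y * _]mulrC.
    apply: le_trans ny; rewrite mulrC -ler_pdivlMr //.
    by rewrite -invfM [c `^ x * _]mulrC ge_min lexx orbT.
  move/(_ h1 h2); rewrite ltNge => /negP; apply.
  have py : p n `^ (- (1 / 4 * k.+1%:R)) * y <= 1.
    rewrite /y -powRD; last by rewrite (gt_eqF pn0) implybT.
    have e : 0 <= - (1 / 4 * k.+1%:R) + x.
      have k1 : 1 <= k%:R :> R by rewrite ler1n -ltnS.
      by rewrite /x -[k.+1%:R]natr1; lra.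
    apply: (@le_trans _ _ (1 `^ (- (1 / 4 * k.+1%:R) + x))).
      by rewrite ge0_ler_powR ?nnegrE.
    by rewrite powR1.
  move: hq; rewrite ger0_norm // ger0_norm ?powR_ge0 // => hq.
  apply: (@le_trans _ _ (a / 12 * p n `^ (- (1 / 4 * k.+1%:R)) * y)).
    by rewrite ler_pM2r.
  by rewrite -mulrA ler_piMr // ltW.
Unshelve. all: by end_near.
Qed.
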